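(* Let $\lambda$ be a real number with $0<|\lambda|<\pi/3$, and let $a,b$ be complex numbers such that $q=ab$ is a positive real number. Then the shifted hypergeometric function $z\,{}_2F_1(a,b;a+b+1;z)$ is $\lambda$-spirallike if $$\left(\operatorname{Im}[e^{i\lambda}(a+b)]-2\sin2\lambda\cos\lambda\right)^2\le(4\cos^2\lambda-1)\left(2\operatorname{Re}[e^{i\lambda}(a+b)]\cos\lambda-4\cos^4\lambda+3\cos^2\lambda-q\right).$$
   Context: $\mathbb{D}=\{z\in\mathbb{C}:|z|<1\}$. For $a,b,c\in\mathbb{C}$ with $c\ne0,-1,-2,\dots$, the Gaussian hypergeometric function is ${}_2F_1(a,b;c;z)=\sum_{n=0}^\infty\frac{(a)_n(b)_n}{(c)_n n!}z^n$ for $z\in\mathbb{D}$, where $(a)_0=1$ and $(a)_n=a(a+1)\cdots(a+n-1)$. For $\lambda\in(-\pi/2,\pi/2)$, an analytic function $f$ on $\mathbb{D}$ with $f(0)=0$, $f'(0)=1$ is called $\lambda$-spirallike if $\operatorname{Re}\left(e^{-i\lambda}\frac{zf'(z)}{f(z)}\right)>0$ for all $z\in\mathbb{D}$ (the quotient taking the value $1$ at $z=0$). *)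

(* Defs.v *)
From Stdlib Require Import Reals Factorial.
From Coquelicot Require Import Coquelicot.

Local Open Scope C_scope.

(* The total sum of a complex series, taken componentwise; it is the genuine sum
   whenever the series converges (is_series_CSeries). *)
Definition CSeries (u : nat -> C) : C :=
  (Series (fun n => Re (u n)), Series (fun n => Im (u n))).

Lemma sum_n_Re_Im (u : nat -> C) (n : nat) :
  sum_n (G := C_AbelianMonoid) u n =
  (sum_n (fun k => Re (u k)) n, sum_n (fun k => Im (u k)) n).
Proof.
  induction n as [|n IH].
  - rewrite !sum_O. apply surjective_pairing.
  - rewrite !sum_Sn, IH. reflexivity.
Qed.

Lemma is_series_CSeries (u : nat -> C) (l : C) :
  is_series (K := C_AbsRing) (V := C_NormedModule) u l -> CSeries u = l.
Proof.
  intros H; rewrite (surjective_pairing l); unfold CSeries.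
  f_equal; apply is_series_unique; unfold is_series;
    apply filterlim_locally; intros eps;
    generalize (proj1 (filterlim_locally _ _) H eps); apply filter_imp;
    intros n Hn; rewrite sum_n_Re_Im in Hn; apply Hn.
Qed.

Fixpoint pochhammer (a : C) (n : nat) : C :=
  match n with
  | O => 1
  | S m => pochhammer a m * (a + RtoC (INR m))
  end.

(* Meaningful only when c is not 0, -1, -2, ... and |z| < 1. *)
Definition hypergeom2F1 (a b c z : C) : C :=
  CSeries (fun n =>
    pochhammer a n * pochhammer b n /
    (pochhammer c n * RtoC (INR (fact n))) * z ^ n).

(* e^(i t) for real t *)
Definition cis (t : R) : C := (cos t, sin t).

Definition analytic_on_disk (f : C -> C) : Prop :=
  forall z : C, (Cmod z < 1)%R ->
    ex_derive (K := C_AbsRing) (V := C_NormedModule) f z.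

Definition zf_quotient (f : C -> C) (z : C) : C :=
  if Ceq_dec z 0 then 1 else z * C_derive f z / f z.

(* The requirement f z <> 0 makes explicit that the quotient is well defined,
   since division in C is total. *)
Definition spirallike (lambda : R) (f : C -> C) : Prop :=
  (- (PI / 2) < lambda < PI / 2)%R /\
  analytic_on_disk f /\
  f 0 = 0 /\
  C_derive f 0 = 1 /\
  (forall z : C, (Cmod z < 1)%R -> z <> 0 -> f z <> 0) /\
  (forall z : C, (Cmod z < 1)%R -> (0 < Re (cis (- lambda) * zf_quotient f z))%R).

(* Main.v *)
Require Import Defs.
From Stdlib Require Import Reals Lra Lia Psatz ClassicalEpsilon Factorial Nsatz.
From Coquelicot Require Import Coquelicot.

(** Write [F] for the hypergeometric function, [s = a + b], [k = e^(-i lambda)] and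
    [D = 2 cos(lambda) F + k z F'].  The claim is equivalent to [|z F'| < |D|] on the
    disk, which also forces [F z <> 0].  If it fails, take a point [z0] of least modulus
    where it fails.  Then [psi = F' / D] is holomorphic on the closed disk of radius
    [|z0|] and bounded there by [1 / |z0| = |psi z0|] (maximum modulus), so
    [z0 psi'(z0) / psi(z0)] is real and nonnegative (Jack's lemma).  Feeding this into
    the equation [(1 - z) (z F'' + (s + 1) F') = q F], which holds because
    [c = a + b + 1], expresses [q z0 / (1 - z0)] through [z0 F'(z0) / F(z0)]; the
    hypothesis on [a, b] makes its real part at most [- q / 2], whereas
    [Re (z / (1 - z)) > - 1 / 2] on the disk. *)

Local Open Scope R_scope.

(** Origin of [D]: for [w = z F' / F] and [c = cos lambda], [|2 c + k w|^2 - |w|^2 = 4 c (c + Re (k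
    w))], so [w / (2 c + k w)] maps the half-plane [Re (k (1 + w)) > 0] onto the unit disk and fixes
    0. Multiplying through by [F] gives [z F' / D], which makes sense before [F] is known to have no
    zeros. On the closed disk of radius [|z0|], a zero of [D] would be a common zero of [F] and
    [z F'], which the differential equation excludes. Dividing by [z] in [psi] sharpens the boundary
    information: the logarithmic derivative of [z F' / D] at [z0], multiplied by [z0], is at least 1
    rather than at least 0, and this 1 enters the final estimate. Origin of the hypothesis: at [z0]
    one has [k w = - c + i v] with [v] real, and [2 Re (q z0 / (1 - z0)) + q] is bounded by a
    quadratic in [v] with leading coefficient [- (4 c^2 - 1)]. The bound [|lambda| < PI / 3] makes
    it concave, and the assumed inequality says exactly that its maximum is at most 0. *)

Local Notation Cderive_at f z l :=
  (is_derive (K := C_AbsRing) (V := C_NormedModule) f z l).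
(* Continuity for the topology given by [Cmod], the one underlying [Cderive_at];
   Coquelicot's default uniform structure on [C] is that of the product. *)
Local Notation Ccontinuous f z :=
  (continuous (T := AbsRing_UniformSpace C_AbsRing) (U := R_UniformSpace) f z).

(* [ring] does not see through the canonical structures in which Coquelicot types
   real equalities. *)
Ltac Rring := match goal with |- @eq _ ?a ?b => change (@eq R a b); ring end.

(** * Complex differentiation *)

Lemma is_derive_C_eps (f : C -> C) (z l : C) :
  Cderive_at f z l <->
  forall eps, 0 < eps -> exists delta, 0 < delta /\
    forall y, Cmod (y - z) < delta ->
      Cmod (f y - f z - (y - z) * l) <= eps * Cmod (y - z).
Proof.
  split.
  - intros [_ H] eps Heps.
    destruct (H z (fun P HP => HP) (mkposreal eps Heps)) as [d Hd].
    exists d; split; [apply cond_pos|]; intros y Hy; exact (Hd y Hy).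
  - intros H; split; [apply is_linear_scal_l|].
    intros x Hx eps.
    apply (@is_filter_lim_locally_unique C_AbsRing (AbsRing_NormedModule C_AbsRing)) in Hx.
    rewrite <- Hx.
    destruct (H eps (cond_pos eps)) as [d [Hd H1]].
    exists (mkposreal d Hd); intros y Hy; exact (H1 y Hy).
Qed.

(** [C] is a normed module over itself in two ways that share the same norm; the generic product and
    chain rules are stated for the second one. *)
Lemma is_derive_C_AbsRing (f : C -> C) (z l : C) :
  Cderive_at f z l <->
  is_derive (K := C_AbsRing) (V := AbsRing_NormedModule C_AbsRing) f z l.
Proof.
  split; intros [H1 H2].
  - split; [apply is_linear_scal_l|exact H2].
  - split; [apply is_linear_scal_l|exact H2].
Qed.

Lemma is_derive_R_eps (f : R -> R) (x l : R) :
  (forall eps, 0 < eps -> exists delta, 0 < delta /\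
    forall y, Rabs (y - x) < delta ->
      Rabs (f y - f x - (y - x) * l) <= eps * Rabs (y - x)) ->
  is_derive f x l.
Proof.
  intros H; split; [apply is_linear_scal_l|].
  intros x' Hx eps.
  apply (@is_filter_lim_locally_unique R_AbsRing (AbsRing_NormedModule R_AbsRing)) in Hx; rewrite <- Hx.
  destruct (H eps (cond_pos eps)) as [d [Hd H1]].
  exists (mkposreal d Hd); intros y Hy; exact (H1 y Hy).
Qed.

Lemma is_derive_C_mult (f g : C -> C) (z df dg : C) :
  Cderive_at f z df -> Cderive_at g z dg ->
  Cderive_at (fun x => f x * g x)%C z (df * g z + f z * dg)%C.
Proof.
  intros Hf Hg; apply is_derive_C_AbsRing.
  apply is_derive_C_AbsRing in Hf, Hg.
  exact (is_derive_mult f g z df dg Hf Hg Cmult_comm).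
Qed.

Lemma is_derive_C_plus (f g : C -> C) (z df dg : C) :
  Cderive_at f z df -> Cderive_at g z dg ->
  Cderive_at (fun x => f x + g x)%C z (df + dg)%C.
Proof. exact (is_derive_plus f g z df dg). Qed.

Lemma is_derive_C_const (k z : C) : Cderive_at (fun _ => k) z (RtoC 0).
Proof. exact (is_derive_const (V := C_NormedModule) k z). Qed.

Lemma is_derive_C_id (z : C) : Cderive_at (fun x => x) z (RtoC 1).
Proof. apply is_derive_C_AbsRing; exact (is_derive_id z). Qed.

Lemma is_derive_C_ext (f g : C -> C) (z l m : C) :
  (forall x, f x = g x) -> l = m -> Cderive_at f z l -> Cderive_at g z m.
Proof. intros H <-; apply is_derive_ext; exact H. Qed.

Lemma is_derive_C_scal (f : C -> C) (k z df : C) :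
  Cderive_at f z df -> Cderive_at (fun x => k * f x)%C z (k * df)%C.
Proof.
  intros Hf.
  refine (is_derive_C_ext _ _ _ _ _ (fun _ => eq_refl) _
    (is_derive_C_mult _ _ _ _ _ (is_derive_C_const k z) Hf)); cbv beta; ring.
Qed.

Lemma is_derive_C_minus (f g : C -> C) (z df dg : C) :
  Cderive_at f z df -> Cderive_at g z dg ->
  Cderive_at (fun x => f x - g x)%C z (df - dg)%C.
Proof. exact (is_derive_minus f g z df dg). Qed.

Lemma is_derive_C_inv (z : C) :
  z <> 0%C -> Cderive_at Cinv z (- / (z * z))%C.
Proof.
  intros Hz; apply is_derive_C_eps; intros eps Heps.
  assert (Hm : 0 < Cmod z) by (apply Cmod_gt_0; exact Hz).
  set (m := Cmod z) in *.
  assert (Hm3 : 0 < m ^ 3) by (apply pow_lt; lra).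
  (* The remainder is exactly [(y - z)^2 / (z^2 y)]. The first bound keeps [|y| > m / 2], so the
     remainder is at most [2 |y - z|^2 / m^3], which the second bound controls. *)
  exists (Rmin (m / 2) (eps * m ^ 3 / 2)); split.
  { apply Rmin_glb_lt; [lra|]. apply Rdiv_lt_0_compat; [|lra]. nra. }
  intros y Hy.
  assert (Hy1 : Cmod (y - z) < m / 2) by (eapply Rlt_le_trans; [apply Hy|apply Rmin_l]).
  assert (Hy2 : Cmod (y - z) < eps * m ^ 3 / 2) by (eapply Rlt_le_trans; [apply Hy|apply Rmin_r]).
  assert (Hym : m / 2 < Cmod y).
  { assert (T := Cmod_triangle y (- (y - z))%C).
    replace (y + - (y - z))%C with z in T by ring.
    rewrite Cmod_opp in T; fold m in T; lra. }
  assert (Hy0 : y <> 0%C) by (apply Cmod_gt_0; lra).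
  replace (/ y - / z - (y - z) * - / (z * z))%C
    with ((y - z) * ((y - z) / (z * z * y)))%C by (field; auto).
  rewrite Cmod_mult, Rmult_comm.
  apply Rmult_le_compat_r; [apply Cmod_ge_0|].
  rewrite Cmod_div, !Cmod_mult by (repeat apply Cmult_neq_0; auto).
  fold m.
  apply Rle_div_l; [apply Rmult_lt_0_compat; nra|].
  apply Rle_trans with (eps * m ^ 3 / 2); [lra|].
  replace (eps * m ^ 3 / 2) with (eps * (m * m * (m / 2))) by field.
  apply Rmult_le_compat_l; [lra|].
  apply Rmult_le_compat_l; nra.
Qed.

Lemma is_derive_C_div (f g : C -> C) (z df dg : C) :
  g z <> 0%C -> Cderive_at f z df -> Cderive_at g z dg ->
  Cderive_at (fun x => f x / g x)%C z ((df * g z - f z * dg) / (g z * g z))%C.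
Proof.
  intros H0 Hf Hg.
  assert (Hi : Cderive_at (fun x => / g x)%C z (dg * - / (g z * g z))%C).
  { apply is_derive_C_AbsRing in Hg.
    exact (is_derive_comp (V := C_NormedModule) Cinv g z _ _ (is_derive_C_inv _ H0) Hg). }
  refine (is_derive_C_ext _ _ _ _ _ (fun _ => eq_refl) _
    (is_derive_C_mult _ _ _ _ _ Hf Hi)); cbv beta; field; auto.
Qed.

Lemma is_derive_C_cont (f : C -> C) (z l : C) :
  Cderive_at f z l -> forall eps, 0 < eps -> exists delta, 0 < delta /\
    forall y, Cmod (y - z) < delta -> Cmod (f y - f z) < eps.
Proof.
  intros H eps Heps.
  destruct (proj1 (is_derive_C_eps f z l) H 1 Rlt_0_1) as [d [Hd H1]].
  assert (Hl := Cmod_ge_0 l).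
  assert (He : 0 < eps / (Cmod l + 2)) by (apply Rdiv_lt_0_compat; lra).
  exists (Rmin d (eps / (Cmod l + 2))); split; [apply Rmin_glb_lt; auto|].
  intros y Hy.
  assert (E := Rmin_l d (eps / (Cmod l + 2))); assert (E' := Rmin_r d (eps / (Cmod l + 2))).
  specialize (H1 y ltac:(lra)).
  assert (T := Cmod_triangle (f y - f z - (y - z) * l) ((y - z) * l)).
  replace (f y - f z - (y - z) * l + (y - z) * l)%C with (f y - f z)%C in T by ring.
  rewrite Cmod_mult in T.
  assert (Hy' : Cmod (y - z) < eps / (Cmod l + 2)) by lra.
  apply Rlt_div_r in Hy'; [|lra].
  assert (Z := Cmod_ge_0 (y - z)).
  nra.
Qed.

Lemma im_le_Cmod (c : C) : Rabs (Im c) <= Cmod c.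
Proof.
  eapply Rle_trans; [|apply Rmax_Cmod]; apply Rmax_r.
Qed.

Section Line.
Variables (f : C -> C) (z d l : C) (t : R).
Hypothesis Hf : Cderive_at f (z + t * d)%C l.

(** Only real linearity and [|p u| <= |u|] matter, so [Re] and [Im] are treated together. *)
Let eps_line (p : C -> R) :
  (forall u v, p (u - v)%C = p u - p v) ->
  (forall (r : R) u, p (r * u)%C = r * p u) ->
  (forall u, Rabs (p u) <= Cmod u) ->
  is_derive (fun t : R => p (f (z + t * d)%C)) t (p (l * d)%C).
Proof.
  intros Hm Hs Hb; apply is_derive_R_eps; intros eps Heps.
  assert (Hd := Cmod_ge_0 d).
  assert (He : 0 < eps / (Cmod d + 1)) by (apply Rdiv_lt_0_compat; lra).
  destruct (proj1 (is_derive_C_eps _ _ _) Hf _ He) as [e [He1 H1]].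
  assert (He2 : 0 < e / (Cmod d + 1)) by (apply Rdiv_lt_0_compat; lra).
  exists (e / (Cmod d + 1)); split; [exact He2|]; intros y Hy.
  apply Rlt_div_r in Hy; [|lra].
  assert (Ha := Rabs_pos (y - t)).
  assert (E : (z + y * d - (z + t * d) = (y - t)%R * d)%C) by (rewrite RtoC_minus; ring).
  specialize (H1 (z + y * d)%C); rewrite E, Cmod_mult, Cmod_R in H1.
  specialize (H1 ltac:(nra)).
  rewrite <- Hs, <- !Hm.
  eapply Rle_trans; [apply Hb|].
  replace ((y - t)%R * (l * d))%C with ((y - t)%R * d * l)%C by ring.
  eapply Rle_trans; [apply H1|].
  apply Rle_trans with (eps / (Cmod d + 1) * (Cmod d + 1) * Rabs (y - t)).
  { rewrite Rmult_assoc. apply Rmult_le_compat_l; nra. }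
  right; field; lra.
Qed.

Lemma is_derive_Re_line : is_derive (fun t : R => Re (f (z + t * d)%C)) t (Re (l * d)%C).
Proof.
  apply eps_line; [|apply re_scal_l|apply re_le_Cmod].
  intros u v; unfold Re, Im; simpl; ring.
Qed.

Lemma is_derive_Im_line : is_derive (fun t : R => Im (f (z + t * d)%C)) t (Im (l * d)%C).
Proof.
  apply eps_line; [| |apply im_le_Cmod].
  - intros u v; unfold Re, Im; simpl; ring.
  - intros r u; unfold Re, Im; simpl; ring.
Qed.
End Line.

(** * Maximum modulus and Jack's lemma *)

Lemma Cmod_le_Rabs (z : C) : Cmod z <= Rabs (Re z) + Rabs (Im z).
Proof.
  assert (T := Cmod_triangle (Re z) (Ci * Im z)%C).
  rewrite Cmod_mult, Cmod_Ci, !Cmod_R in T.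
  replace (Re z + Ci * Im z)%C with z in T.
  - lra.
  - apply injective_projections; unfold Re, Im; simpl; ring.
Qed.

Lemma Cmod_minus_sym (x y : C) : Cmod (x - y) = Cmod (y - x).
Proof. rewrite <- Cmod_opp; f_equal; ring. Qed.

Lemma Cmod_lip (x y : C) : Rabs (Cmod x - Cmod y) <= Cmod (x - y).
Proof.
  assert (T := Cmod_triangle (x - y) y); assert (T' := Cmod_triangle (y - x) x).
  replace (x - y + y)%C with x in T by ring.
  replace (y - x + x)%C with y in T' by ring.
  rewrite (Cmod_minus_sym y x) in T'.
  apply Rabs_le; lra.
Qed.

Lemma Ccontinuous_eps (f : C -> R) (z : C) :
  Ccontinuous f z <->
  forall eps, 0 < eps -> exists delta, 0 < delta /\
    forall y, Cmod (y - z) < delta -> Rabs (f y - f z) < eps.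
Proof.
  split; intros H.
  - intros eps Heps.
    destruct (proj1 (filterlim_locally _ _) H (mkposreal eps Heps)) as [d Hd].
    exists d; split; [apply cond_pos|]; intros y Hy; exact (Hd y Hy).
  - apply (proj2 (filterlim_locally _ _)); intros eps.
    destruct (H eps (cond_pos eps)) as [d [Hd H1]].
    exists (mkposreal d Hd); intros y Hy; exact (H1 y Hy).
Qed.

Lemma Ccontinuous_Cmod (f : C -> C) (z l : C) :
  Cderive_at f z l -> Ccontinuous (fun x => Cmod (f x)) z.
Proof.
  intros H; apply Ccontinuous_eps; intros eps Heps.
  destruct (is_derive_C_cont f z l H eps Heps) as [d [Hd H1]].
  exists d; split; [exact Hd|]; intros y Hy.
  eapply Rle_lt_trans; [apply Cmod_lip|apply H1, Hy].
Qed.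

Lemma Ccontinuous_Cmod2 (f : C -> C) (z l : C) :
  Cderive_at f z l -> Ccontinuous (fun x => Cmod (f x) ^ 2) z.
Proof.
  intros H; assert (H1 := Ccontinuous_Cmod f z l H).
  apply (continuous_ext (T := AbsRing_UniformSpace C_AbsRing)) with (fun x => mult (K := R_AbsRing) (Cmod (f x)) (Cmod (f x))).
  - intros x; unfold mult; simpl; ring.
  - exact (continuous_mult (U := AbsRing_UniformSpace C_AbsRing) (K := R_AbsRing) _ _ _ H1 H1).
Qed.

(** * Compactness: continuous functions attain their maximum on bounded closed sets *)

Section Compact.
Variables (K : C -> Prop) (B : R).
Hypothesis K_bounded : forall y, K y -> Cmod y <= B.

(** A finite subcover argument in the form of a gauge: a property that holds near every point with
    some margin [d], and persists for smaller margins, holds on [K] with one margin. *)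
Lemma compact_uniform (P : R -> C -> Prop) :
  (forall d d' y, 0 < d' <= d -> P d y -> P d' y) ->
  (forall p, exists d, 0 < d /\ forall y, K y -> Cmod (y - p) < d -> P d y) ->
  exists d, 0 < d /\ forall y, K y -> P d y.
Proof.
  intros Pmono Ploc.
  destruct (choice (fun (p : C) (d : posreal) =>
    forall y, K y -> Cmod (y - p) < d -> P d y)) as [dl Hdl].
  { intros p; destruct (Ploc p) as [d [Hd H]]; exists (mkposreal d Hd); exact H. }
  (* The gauge theorem bounds the two coordinates separately; halving makes the sum of both
     deviations, hence the modulus, less than [dl p]. *)
  assert (Hh : forall p, 0 < dl p / 2) by (intros p; assert (T := cond_pos (dl p)); lra).
  destruct (compactness_value_2d (- B) B (- B) B (fun u v => mkposreal _ (Hh (u, v))))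
    as [d Hd].
  exists d; split; [apply cond_pos|]; intros y Hy.
  assert (Hb := K_bounded y Hy).
  assert (Hr := re_le_Cmod y); assert (Hi := im_le_Cmod y).
  apply NNPP; intros HnP.
  apply (Hd (Re y) (Im y)).
  - apply Rabs_le_between; lra.
  - apply Rabs_le_between; lra.
  - intros [u [v [_ [_ [H1 [H2 H3]]]]]]; simpl in H1, H2, H3.
    apply HnP, (Pmono (dl (u, v))).
    + assert (T := cond_pos d); assert (T' := cond_pos (dl (u, v))); lra.
    + apply Hdl; [exact Hy|].
      eapply Rle_lt_trans; [apply Cmod_le_Rabs|].
      change (Re (y - (u, v))) with (Re y - u).
      change (Im (y - (u, v))) with (Im y - v); lra.
Qed.

Hypothesis K_closed : forall p, ~ K p ->
  exists d, 0 < d /\ forall y, Cmod (y - p) < d -> ~ K y.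

(** [compact_uniform] is used twice: with [f y <= / d] it yields a bound, hence a supremum [M]; with
    [f y <= M - d] it contradicts the supremum if [M] is not attained. Points outside [K] have
    neighbourhoods missing [K], where nothing is to be shown. *)
Lemma continuous_max (f : C -> R) (p0 : C) :
  K p0 -> (forall p, K p -> Ccontinuous f p) ->
  exists p, K p /\ forall y, K y -> f y <= f p.
Proof.
  intros Hp0 Hf.
  destruct (compact_uniform (fun d y => f y <= / d)) as [d0 [Hd0 Hbd]].
  { intros d d' y [Hd Hd'] H; eapply Rle_trans; [exact H|].
    apply Rinv_le_contravar; lra. }
  { intros p; destruct (excluded_middle_informative (K p)) as [Kp|Kp].
    - destruct (proj1 (Ccontinuous_eps _ _) (Hf p Kp) 1 Rlt_0_1) as [d [Hd H]].
      assert (Hpos : 0 < Rabs (f p) + 1) by (assert (T := Rabs_pos (f p)); lra).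
      assert (Hinv := Rinv_0_lt_compat _ Hpos).
      exists (Rmin d (/ (Rabs (f p) + 1))); split; [apply Rmin_glb_lt; auto|].
      intros y _ Hy.
      assert (E := Rmin_l d (/ (Rabs (f p) + 1))).
      assert (E' := Rmin_r d (/ (Rabs (f p) + 1))).
      assert (E0 : 0 < Rmin d (/ (Rabs (f p) + 1))) by (apply Rmin_glb_lt; auto).
      specialize (H y ltac:(lra)); apply Rabs_def2 in H.
      apply Rinv_le_contravar in E'; [|exact E0].
      rewrite Rinv_inv in E'.
      assert (T := Rle_abs (f p)); lra.
    - destruct (K_closed p Kp) as [d [Hd H]].
      exists d; split; [exact Hd|]; intros y Ky Hy; destruct (H y Hy Ky). }
  destruct (completeness (fun v => exists y, K y /\ v = f y)) as [M [HM1 HM2]].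
  { exists (/ d0); intros v [y [Ky ->]]; apply Hbd, Ky. }
  { exists (f p0), p0; auto. }
  destruct (excluded_middle_informative (exists p, K p /\ f p = M)) as [[p [Kp Ep]]|Hno].
  { exists p; split; [exact Kp|]; intros y Ky; rewrite Ep; apply HM1; exists y; auto. }
  exfalso.
  destruct (compact_uniform (fun d y => f y <= M - d)) as [d1 [Hd1 Hb1]].
  { intros; lra. }
  { intros p; destruct (excluded_middle_informative (K p)) as [Kp|Kp].
    - assert (Hlt : f p < M).
      { destruct (HM1 (f p) ltac:(exists p; auto)) as [H|H]; [exact H|].
        destruct Hno; exists p; auto. }
      destruct (proj1 (Ccontinuous_eps _ _) (Hf p Kp) ((M - f p) / 2) ltac:(lra)) as [d [Hd H]].
      exists (Rmin d ((M - f p) / 2)); split; [apply Rmin_glb_lt; lra|].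
      intros y _ Hy.
      assert (E := Rmin_l d ((M - f p) / 2)); assert (E' := Rmin_r d ((M - f p) / 2)).
      specialize (H y ltac:(lra)); apply Rabs_def2 in H; lra.
    - destruct (K_closed p Kp) as [d [Hd H]].
      exists d; split; [exact Hd|]; intros y Ky Hy; destruct (H y Hy Ky). }
  assert (M <= M - d1); [|lra].
  apply HM2; intros v [y [Ky ->]]; apply Hb1, Ky.
Qed.
End Compact.

(** * Derivative tests at a maximum along lines *)

Lemma is_derive_pos_increase (u : R -> R) (x l : R) :
  is_derive u x l -> 0 < l ->
  exists d, 0 < d /\ forall t, x < t < x + d -> u x < u t.
Proof.
  intros H Hl; apply is_derive_Reals in H.
  destruct (H (l / 2) ltac:(lra)) as [d Hd].
  exists d; split; [apply cond_pos|]; intros t Ht.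
  specialize (Hd (t - x) ltac:(lra) ltac:(rewrite Rabs_right; lra)).
  replace (x + (t - x)) with t in Hd by ring.
  apply Rabs_def2 in Hd.
  assert (Hq : 0 < (u t - u x) / (t - x)) by lra.
  apply Rmult_lt_compat_r with (r := t - x) in Hq; [|lra].
  rewrite Rmult_0_l in Hq; unfold Rdiv in Hq.
  rewrite Rmult_assoc, Rinv_l, Rmult_1_r in Hq by lra; lra.
Qed.

(** If [0 < l], then [u'] exceeds [u' 0] just to the right of 0. Since [0 <= u' 0] by maximality on
    the left, the mean value theorem makes [u] exceed [u 0]. *)
Lemma local_max_second_derivative (u u' : R -> R) (l r : R) :
  0 < r -> (forall t, Rabs t < r -> is_derive u t (u' t)) ->
  is_derive u' 0 l -> (forall t, Rabs t < r -> u t <= u 0) -> l <= 0.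
Proof.
  intros Hr Hu Hu' Hmax; apply Rnot_lt_le; intros Hl.
  assert (H0 : Rabs 0 < r) by (rewrite Rabs_R0; exact Hr).
  assert (E0 : 0 <= u' 0).
  { apply Rnot_lt_le; intros Hneg.
    destruct (is_derive_pos_increase (fun t => u (- t)) 0 (- u' 0)) as [d [Hd H]].
    - evar_last.
      + apply is_derive_comp with (f := u) (g := fun t => - t).
        * rewrite Ropp_0; apply Hu, H0.
        * auto_derive; [exact I|reflexivity].
      + unfold scal; simpl; unfold mult; simpl; ring.
    - lra.
    - assert (Ed := Rmin_l d r); assert (Er := Rmin_r d r).
      assert (Ep : 0 < Rmin d r) by (apply Rmin_glb_lt; auto).
      specialize (H (Rmin d r / 2) ltac:(lra)); rewrite Ropp_0 in H.
      specialize (Hmax (- (Rmin d r / 2)) ltac:(rewrite Rabs_left; lra)); lra. }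
  destruct (is_derive_pos_increase u' 0 l Hu' Hl) as [d [Hd H]].
  assert (Ed := Rmin_l d r); assert (Er := Rmin_r d r).
  assert (Ep : 0 < Rmin d r) by (apply Rmin_glb_lt; auto).
  set (t := Rmin d r / 2).
  assert (Ht : 0 < t) by (unfold t; lra).
  destruct (MVT_cor2 u u' 0 t Ht) as [c [Ec Hc]].
  { intros x Hx; apply is_derive_Reals, Hu; rewrite Rabs_right; unfold t in *; lra. }
  specialize (Hmax t ltac:(rewrite Rabs_right; unfold t in *; lra)).
  specialize (H c ltac:(unfold t in *; lra)); nra.
Qed.

(** The polarised form serves twice: [f = g] differentiates [|f|^2] along a line, and a second use
    with [f = psi' d], [g = psi] gives the second derivative of [|psi|^2]. *)
Lemma is_derive_Re_conj_line (f g : C -> C) (z d l m : C) (t : R) :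
  Cderive_at f (z + t * d)%C l -> Cderive_at g (z + t * d)%C m ->
  is_derive (fun t : R => Re (f (z + t * d) * Cconj (g (z + t * d)))%C) t
    (Re (l * d * Cconj (g (z + t * d)) + f (z + t * d) * Cconj (m * d))%C).
Proof.
  intros Hf Hg.
  apply is_derive_ext with
    (fun t : R => Re (f (z + t * d)%C) * Re (g (z + t * d)%C)
                + Im (f (z + t * d)%C) * Im (g (z + t * d)%C)).
  { intros x; rewrite re_mult, re_conj, im_conj.
    Rring. }
  assert (A2 := is_derive_mult _ _ _ _ _ (is_derive_Re_line _ _ _ _ _ Hf)
    (is_derive_Re_line _ _ _ _ _ Hg) Rmult_comm).
  assert (B2 := is_derive_mult _ _ _ _ _ (is_derive_Im_line _ _ _ _ _ Hf)
    (is_derive_Im_line _ _ _ _ _ Hg) Rmult_comm).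
  assert (S := is_derive_plus _ _ _ _ _ A2 B2).
  eapply is_derive_ext; [|eapply (eq_rect _ (fun l => is_derive _ t l) S)].
  - intros x; reflexivity.
  - unfold plus, mult; simpl; unfold mult; simpl.
    unfold Re, Im, Cconj; simpl; ring.
Qed.

Lemma is_derive_Cmod2_line (f : C -> C) (z d l : C) (t : R) :
  Cderive_at f (z + t * d)%C l ->
  is_derive (fun t : R => Cmod (f (z + t * d)%C) ^ 2) t
    (2 * Re (l * d * Cconj (f (z + t * d)))%C).
Proof.
  intros H.
  apply is_derive_ext with (fun t : R => Re (f (z + t * d) * Cconj (f (z + t * d)))%C).
  { intros x; rewrite Cmod2_alt, re_mult, re_conj, im_conj.
    Rring. }
  evar_last; [apply (is_derive_Re_conj_line f f z d l l t H H)|].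
  rewrite Cmult_conj; unfold Re, Cconj; simpl; ring.
Qed.

Section Modulus.
Variables (psi psi' : C -> C) (r : R).
Hypothesis r_pos : 0 < r.
Hypothesis psi_derive : forall z, Cmod z <= r -> Cderive_at psi z (psi' z).

(* At an interior maximum the second derivatives along the directions [1] and [i] are
   nonpositive, but they add up to [4 |psi' p|^2 + 4 eps]. *)
Lemma no_interior_max (p : C) (eps : R) :
  (forall z, Cmod z < r -> exists l, Cderive_at psi' z l) ->
  0 < eps -> Cmod p < r ->
  exists y, Cmod y < r /\
    Cmod (psi p) ^ 2 + eps * Cmod p ^ 2 < Cmod (psi y) ^ 2 + eps * Cmod y ^ 2.
Proof.
  intros psi'_derive Heps Hp.
  destruct (psi'_derive p Hp) as [psi''p psi'_derive_p].
  destruct (excluded_middle_informative (exists y, Cmod y < r /\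
    Cmod (psi p) ^ 2 + eps * Cmod p ^ 2 < Cmod (psi y) ^ 2 + eps * Cmod y ^ 2))
    as [H|H]; [exact H|exfalso].
  assert (Hmax : forall y, Cmod y < r ->
    Cmod (psi y) ^ 2 + eps * Cmod y ^ 2 <= Cmod (psi p) ^ 2 + eps * Cmod p ^ 2).
  { intros y Hy; apply Rnot_lt_le; intros Hlt; apply H; exists y; auto. }
  assert (Hdir : forall d, Cmod d = 1 ->
    2 * Re (psi''p * d * d * Cconj (psi p) + psi' p * d * Cconj (psi' p * d))%C
      + eps * 2 <= 0).
  { intros d Hd.
    assert (Hin : forall t : R, Rabs t < r - Cmod p -> Cmod (p + t * d)%C < r).
    { intros t Ht; assert (T := Cmod_triangle p (t * d)).
      rewrite Cmod_mult, Cmod_R, Hd in T; lra. }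
    assert (E0 : forall x : C, (x + 0%R * d)%C = x) by (intros x; ring).
    apply local_max_second_derivative with (r := r - Cmod p)
      (u := fun t => Cmod (psi (p + t * d)%C) ^ 2 + eps * Cmod (p + t * d)%C ^ 2)
      (u' := fun t => 2 * Re (psi' (p + t * d) * d * Cconj (psi (p + t * d)))%C
                    + eps * (2 * Re (1 * d * Cconj (p + t * d))%C)); [lra| | |].
    - intros t Ht; specialize (Hin t Ht).
      apply (is_derive_plus (V := R_NormedModule)).
      + apply is_derive_Cmod2_line, psi_derive; lra.
      + apply (is_derive_scal (fun t : R => Cmod (p + t * d)%C ^ 2)).
        exact (is_derive_Cmod2_line (fun x => x) p d _ t (is_derive_C_id _)).
    - assert (A1 : is_derive
        (fun t : R => Re (psi' (p + t * d) * d * Cconj (psi (p + t * d)))%C) 0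
        (Re (psi''p * d * d * Cconj (psi p) + psi' p * d * Cconj (psi' p * d))%C)).
      { evar_last.
        - apply (is_derive_Re_conj_line (fun z => psi' z * d)%C psi p d
            (psi''p * d)%C (psi' p) 0); rewrite E0.
          + refine (is_derive_C_ext _ _ _ _ _ _ _
              (is_derive_C_scal psi' d p _ psi'_derive_p)).
            * intros x; cbv beta; ring.
            * ring.
          + apply psi_derive; lra.
        - cbv beta; rewrite E0; reflexivity. }
      assert (A2 : is_derive (fun t : R => Re (1 * d * Cconj (p + t * d))%C) 0 1).
      { evar_last.
        - apply (is_derive_Re_conj_line (fun z => 1 * d)%C (fun z => z) p d
            0 1 0); [apply is_derive_C_const|apply is_derive_C_id].
        - assert (Hd2 := Cmod2_alt d); rewrite Hd in Hd2.
          unfold Re, Im, Cconj in *; simpl in *; lra. }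
      evar_last.
      + apply (is_derive_plus (V := R_NormedModule)).
        * apply (is_derive_scal _ 0 2 _ A1).
        * apply (is_derive_scal _ 0 eps).
          apply (is_derive_scal _ 0 2 _ A2).
      + unfold plus, scal; simpl; unfold mult; simpl; ring.
    - intros t Ht; rewrite E0; apply Hmax, Hin, Ht. }
  (* The terms with [psi''p * d * d] cancel in the sum because the squares of the two directions are
     1 and -1. *)
  assert (D1 := Hdir 1%C Cmod_1); assert (D2 := Hdir Ci Cmod_Ci).
  unfold Re, Cconj, Ci in D1, D2; simpl in D1, D2.
  nra.
Qed.

Lemma closed_disk_compl (p : C) :
  ~ Cmod p <= r -> exists d, 0 < d /\ forall y, Cmod (y - p) < d -> ~ Cmod y <= r.
Proof.
  intros H; exists (Cmod p - r); split; [lra|]; intros y Hy Hy'.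
  assert (T := Cmod_lip y p); apply Rabs_le_between in T; lra.
Qed.

(** Adding [eps |z|^2] makes [|psi|^2] strictly subharmonic, so its maximum over the closed disk
    lies on the circle. Differentiability of [psi'] inside the disk is assumed because the argument
    takes second derivatives instead of using an integral formula. *)
Lemma maximum_modulus (M : R) :
  (forall z, Cmod z < r -> exists l, Cderive_at psi' z l) ->
  (forall z, Cmod z = r -> Cmod (psi z) <= M) ->
  forall z, Cmod z <= r -> Cmod (psi z) <= M.
Proof.
  intros psi'_derive Hbd z Hz.
  assert (HM : 0 <= M).
  { eapply Rle_trans; [apply Cmod_ge_0|apply (Hbd (RtoC r))].
    rewrite Cmod_R, Rabs_right; lra. }
  assert (Hsq : Cmod (psi z) ^ 2 <= M ^ 2).
  { apply Rnot_lt_le; intros Hlt.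
    (* On the circle the perturbation equals [eps * r ^ 2], half of the supposed excess, too little
       to lift [M ^ 2] to [Cmod (psi z) ^ 2]. *)
    set (eps := (Cmod (psi z) ^ 2 - M ^ 2) / (2 * r ^ 2)).
    assert (Hr2 : 0 < r ^ 2) by (apply pow_lt; lra).
    assert (Heps : 0 < eps) by (apply Rdiv_lt_0_compat; lra).
    destruct (continuous_max (fun z => Cmod z <= r) r (fun _ H => H) closed_disk_compl
      (fun z => Cmod (psi z) ^ 2 + eps * Cmod z ^ 2) z Hz) as [p [Kp Hp]].
    { intros p Hp.
      apply (continuous_plus (U := AbsRing_UniformSpace C_AbsRing) (V := R_NormedModule)).
      - exact (Ccontinuous_Cmod2 _ _ _ (psi_derive p Hp)).
      - apply (continuous_scal_r (U := AbsRing_UniformSpace C_AbsRing)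
          (V := R_NormedModule) eps (fun z => Cmod z ^ 2)).
        exact (Ccontinuous_Cmod2 (fun z => z) _ _ (is_derive_C_id p)). }
    destruct (Rle_lt_or_eq_dec _ _ Kp) as [Hlt'|Heq].
    - destruct (no_interior_max p eps psi'_derive Heps Hlt') as [y [Hy Hy']].
      specialize (Hp y ltac:(lra)); lra.
    - specialize (Hp z Hz); cbv beta in Hp; rewrite Heq in Hp.
      assert (T := Hbd p Heq); assert (T' := Cmod_ge_0 (psi p)).
      assert (Cmod (psi p) ^ 2 <= M ^ 2) by (apply pow_incr; lra).
      assert (E : eps * r ^ 2 = (Cmod (psi z) ^ 2 - M ^ 2) / 2) by (unfold eps; field; lra).
      assert (0 <= eps * Cmod z ^ 2) by (apply Rmult_le_pos; [lra|apply pow2_ge_0]).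
      lra. }
  apply Rsqr_incr_0; [unfold Rsqr; lra|apply Cmod_ge_0|exact HM].
Qed.

(* The directions [- z0 eta] with [0 < Re eta] point into the disk, so
   [X = z0 psi'(z0) (conj (psi z0))] satisfies [0 <= Re (X eta)] for all of them. *)
Lemma boundary_max_derivative (z0 : C) :
  Cmod z0 = r -> psi z0 <> 0%C ->
  (forall z, Cmod z <= r -> Cmod (psi z) <= Cmod (psi z0)) ->
  exists k : R, 0 <= k /\ (z0 * psi' z0 = k * psi z0)%C.
Proof.
  intros Hz0 Hnz Hmax.
  set (X := (z0 * psi' z0 * Cconj (psi z0))%C).
  assert (HX : forall eta : C, 0 < Re eta -> 0 <= Re (X * eta)%C).
  { intros eta Heta; apply Rnot_lt_le; intros Hneg.
    assert (E0 : forall x y : C, (x + 0%R * y)%C = x) by (intros x y; ring).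
    destruct (is_derive_pos_increase
      (fun t : R => Cmod (psi (z0 + t * (- (z0 * eta)))%C) ^ 2) 0 (- 2 * Re (X * eta)%C))
      as [d [Hd H]].
    - evar_last.
      + apply (is_derive_Cmod2_line psi z0 (- (z0 * eta))%C (psi' z0) 0).
        rewrite E0; apply psi_derive; lra.
      + cbv beta; rewrite E0.
        replace (psi' z0 * - (z0 * eta) * Cconj (psi z0))%C with (- (X * eta))%C
          by (unfold X; ring).
        rewrite re_opp; ring.
    - lra.
    - assert (Hm := Cmod_ge_0 eta).
      assert (Hpos : 0 < Re eta / (Cmod eta ^ 2 + 1)).
      { apply Rdiv_lt_0_compat; [exact Heta|nra]. }
      (* [|1 - t eta|^2 = 1 - 2 t Re eta + t^2 |eta|^2] is at most 1 for this [t], so the point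
         stays in the closed disk; the [+ 1] leaves slack and keeps the denominator visibly
         positive. *)
      set (t := Rmin (d / 2) (Re eta / (Cmod eta ^ 2 + 1))).
      assert (Ht1 : t <= d / 2) by apply Rmin_l.
      assert (Ht2 : t <= Re eta / (Cmod eta ^ 2 + 1)) by apply Rmin_r.
      assert (Ht0 : 0 < t) by (apply Rmin_glb_lt; lra).
      specialize (H t ltac:(lra)); rewrite E0 in H.
      assert (Hin : Cmod (z0 + t * (- (z0 * eta)))%C <= r).
      { replace (z0 + t * (- (z0 * eta)))%C with (z0 * (1 - t * eta))%C by ring.
        rewrite Cmod_mult, Hz0.
        rewrite <- (Rmult_1_r r) at 2; apply Rmult_le_compat_l; [lra|].
        apply Rsqr_incr_0; [|apply Cmod_ge_0|lra].
        rewrite Rsqr_1; unfold Rsqr.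
        replace (Cmod (1 - t * eta) * Cmod (1 - t * eta)) with (Cmod (1 - t * eta) ^ 2) by ring.
        rewrite Cmod2_alt.
        apply Rle_div_r in Ht2; [|nra].
        rewrite Cmod2_alt in Ht2.
        unfold Re, Im in *; simpl; simpl in Ht2.
        assert (0 <= t * t) by nra.
        nra. }
      specialize (Hmax _ Hin).
      assert (T := Cmod_ge_0 (psi (z0 + t * (- (z0 * eta)))%C)).
      assert (Cmod (psi (z0 + t * (- (z0 * eta)))%C) ^ 2 <= Cmod (psi z0) ^ 2)
        by (apply pow_incr; lra).
      lra. }
  assert (HI : Im X = 0).
  { destruct (Req_dec (Im X) 0) as [H|H]; [exact H|exfalso].
    (* This [eta] is chosen to make [Re (X eta) = -1]. *)
    assert (T := HX (1, (Re X + 1) / Im X) ltac:(simpl; lra)).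
    rewrite re_mult in T; change (0 <= Re X * 1 - Im X * ((Re X + 1) / Im X)) in T.
    replace (Im X * ((Re X + 1) / Im X)) with (Re X + 1) in T by (field; exact H).
    lra. }
  assert (HR : 0 <= Re X).
  { assert (T := HX 1%C ltac:(simpl; lra)); rewrite Cmult_1_r in T; exact T. }
  assert (Hp : 0 < Cmod (psi z0)) by (apply Cmod_gt_0; exact Hnz).
  assert (Hc : Cconj (psi z0) <> 0%C).
  { apply Cmod_gt_0; rewrite Cmod_conj; exact Hp. }
  exists (Re X / Cmod (psi z0) ^ 2); split.
  { apply Rdiv_le_0_compat; [exact HR|apply pow_lt, Hp]. }
  rewrite RtoC_div by (apply Rgt_not_eq, pow_lt, Hp).
  replace (RtoC (Re X)) with X by (apply injective_projections; [reflexivity|exact HI]).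
  rewrite (Cmod2_conj (psi z0)); unfold X; field; split; assumption.
Qed.
End Modulus.

(** * Complex power series *)

Lemma ex_series_dominated (a b : nat -> R) :
  (forall n, Rabs (a n) <= b n) -> ex_series b -> ex_series a.
Proof. exact (ex_series_le (K := R_AbsRing) (V := R_CompleteNormedModule) a b). Qed.

Section AbsoluteSeries.
Variables (u v : nat -> C).
Hypothesis Hu : ex_series (fun n => Cmod (u n)).
Hypothesis Hv : ex_series (fun n => Cmod (v n)).

Lemma ex_series_Re : ex_series (fun n => Re (u n)).
Proof. apply ex_series_dominated with (2 := Hu); intros n; apply re_le_Cmod. Qed.

Lemma ex_series_Im : ex_series (fun n => Im (u n)).
Proof. apply ex_series_dominated with (2 := Hu); intros n; apply im_le_Cmod. Qed.

(** The factor 2 comes from bounding the real and imaginary parts separately; it is harmless in the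
    remainder estimate for which this is used. *)
Lemma Cmod_CSeries_le : Cmod (CSeries u) <= 2 * Series (fun n => Cmod (u n)).
Proof.
  eapply Rle_trans; [apply Cmod_le_Rabs|].
  change (Rabs (Series (fun n => Re (u n))) + Rabs (Series (fun n => Im (u n)))
    <= 2 * Series (fun n => Cmod (u n))).
  assert (Hle : forall p : C -> R, (forall c, Rabs (p c) <= Cmod c) ->
    Rabs (Series (fun n => p (u n))) <= Series (fun n => Cmod (u n))).
  { intros p Hp; eapply Rle_trans; [apply Series_Rabs|].
    - apply ex_series_dominated with (2 := Hu); intros n; rewrite Rabs_Rabsolu; apply Hp.
    - apply Series_le; [|exact Hu]; intros n; split; [apply Rabs_pos|apply Hp]. }
  assert (H1 := Hle Re re_le_Cmod); assert (H2 := Hle Im im_le_Cmod); lra.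
Qed.

Lemma CSeries_scal (k : C) : CSeries (fun n => k * u n)%C = (k * CSeries u)%C.
Proof.
  assert (Hr := ex_series_Re); assert (Hi := ex_series_Im).
  apply injective_projections; simpl.
  - rewrite <- !Series_scal_l, <- Series_minus.
    + reflexivity.
    + exact (ex_series_scal_l (fst k) _ Hr).
    + exact (ex_series_scal_l (snd k) _ Hi).
  - rewrite <- !Series_scal_l, <- Series_plus.
    + reflexivity.
    + exact (ex_series_scal_l (fst k) _ Hi).
    + exact (ex_series_scal_l (snd k) _ Hr).
Qed.

Lemma CSeries_incr_1 : CSeries u = (u O + CSeries (fun n => u (S n)))%C.
Proof.
  apply injective_projections; simpl.
  - exact (Series_incr_1 _ ex_series_Re).
  - exact (Series_incr_1 _ ex_series_Im).
Qed.
End AbsoluteSeries.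

Lemma CSeries_plus (u v : nat -> C) :
  ex_series (fun n => Cmod (u n)) -> ex_series (fun n => Cmod (v n)) ->
  CSeries (fun n => u n + v n)%C = (CSeries u + CSeries v)%C.
Proof.
  intros Hu Hv; apply injective_projections; simpl.
  - exact (Series_plus _ _ (ex_series_Re u Hu) (ex_series_Re v Hv)).
  - exact (Series_plus _ _ (ex_series_Im u Hu) (ex_series_Im v Hv)).
Qed.

Lemma CSeries_ext (u v : nat -> C) : (forall n, u n = v n) -> CSeries u = CSeries v.
Proof.
  intros H; unfold CSeries; f_equal; apply Series_ext; intros n; rewrite H; reflexivity.
Qed.

Definition disk_summable (u : nat -> C) : Prop :=
  forall r, 0 <= r < 1 -> ex_series (fun n => Cmod (u n) * r ^ n).

Definition CPSeries (u : nat -> C) (z : C) : C := CSeries (fun n => u n * z ^ n)%C.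

Definition CPS_derive (u : nat -> C) (n : nat) : C := (RtoC (INR (S n)) * u (S n))%C.

Lemma disk_summable_at (u : nat -> C) (z : C) :
  disk_summable u -> Cmod z < 1 -> ex_series (fun n => Cmod (u n * z ^ n)%C).
Proof.
  intros Hu Hz; apply ex_series_ext with (fun n => Cmod (u n) * Cmod z ^ n).
  - intros n; rewrite Cmod_mult, Cmod_pow; reflexivity.
  - apply Hu; split; [apply Cmod_ge_0|exact Hz].
Qed.

Lemma disk_summable_plus (u v : nat -> C) :
  disk_summable u -> disk_summable v -> disk_summable (fun n => u n + v n)%C.
Proof.
  intros Hu Hv r Hr; eapply ex_series_dominated;
    [|exact (ex_series_plus _ _ (Hu r Hr) (Hv r Hr))].
  intros n; assert (Hp : 0 <= r ^ n) by (apply pow_le; lra).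
  rewrite Rabs_mult, (Rabs_pos_eq _ Hp), (Rabs_pos_eq _ (Cmod_ge_0 _)).
  unfold plus; simpl; rewrite <- Rmult_plus_distr_r.
  apply Rmult_le_compat_r; [exact Hp|apply Cmod_triangle].
Qed.

Lemma disk_summable_scal (k : C) (u : nat -> C) :
  disk_summable u -> disk_summable (fun n => k * u n)%C.
Proof.
  intros Hu r Hr; eapply ex_series_ext; [|exact (ex_series_scal_l (Cmod k) _ (Hu r Hr))].
  intros n; rewrite Cmod_mult; unfold scal; simpl; unfold mult; simpl; Rring.
Qed.

(** Reduces to the real power series with coefficients [|u n|]: termwise differentiation preserves
    its radius of convergence, which is at least the midpoint of [r] and 1. *)
Lemma disk_summable_derive (u : nat -> C) :
  disk_summable u -> disk_summable (CPS_derive u).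
Proof.
  intros Hu r Hr.
  set (a := fun n => Cmod (u n)).
  assert (Hrad : Rbar_lt (Rabs r) (CV_radius (PS_derive a))).
  { rewrite CV_radius_derive.
    apply Rbar_lt_le_trans with (Finite ((1 + r) / 2)).
    - rewrite Rabs_pos_eq by lra; simpl; lra.
    - apply (proj1 (Lub_Rbar_correct (CV_disk a))).
      apply ex_series_ext with (fun n => Cmod (u n) * ((1 + r) / 2) ^ n).
      + intros n; unfold a; symmetry; apply Rabs_pos_eq, Rmult_le_pos;
          [apply Cmod_ge_0|apply pow_le; lra].
      + apply Hu; lra. }
  eapply ex_series_ext; [|exact (CV_disk_inside _ _ Hrad)].
  intros n; cbv beta; unfold PS_derive, CPS_derive, a; rewrite Cmod_mult, Cmod_R.
  assert (0 <= INR (S n)) by apply pos_INR.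
  rewrite (Rabs_pos_eq (INR (S n))) by assumption.
  apply Rabs_pos_eq, Rmult_le_pos; [|apply pow_le; lra].
  apply Rmult_le_pos; [assumption|apply Cmod_ge_0].
Qed.

Lemma disk_summable_INR (u : nat -> C) :
  disk_summable u -> disk_summable (fun n => RtoC (INR n) * u n)%C.
Proof.
  intros Hu r Hr; apply ex_series_incr_1.
  eapply ex_series_ext; [|exact (ex_series_scal_l r _ (disk_summable_derive u Hu r Hr))].
  intros n; cbv beta; unfold scal, CPS_derive; simpl; unfold mult; simpl; Rring.
Qed.

Lemma CPSeries_plus (u v : nat -> C) (z : C) :
  disk_summable u -> disk_summable v -> Cmod z < 1 ->
  CPSeries (fun n => u n + v n)%C z = (CPSeries u z + CPSeries v z)%C.
Proof.
  intros Hu Hv Hz; unfold CPSeries.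
  rewrite <- CSeries_plus by (apply disk_summable_at; assumption).
  apply CSeries_ext; intros n; ring.
Qed.

Lemma CPSeries_scal (k : C) (u : nat -> C) (z : C) :
  disk_summable u -> Cmod z < 1 ->
  CPSeries (fun n => k * u n)%C z = (k * CPSeries u z)%C.
Proof.
  intros Hu Hz; unfold CPSeries.
  rewrite <- CSeries_scal by (apply disk_summable_at; assumption).
  apply CSeries_ext; intros n; ring.
Qed.

Lemma CPSeries_incr_1 (u v : nat -> C) (z : C) :
  disk_summable u -> disk_summable v -> Cmod z < 1 -> (forall n, u (S n) = v n) ->
  CPSeries u z = (u O + z * CPSeries v z)%C.
Proof.
  intros Hu Hv Hz E; unfold CPSeries.
  rewrite CSeries_incr_1 by (apply disk_summable_at; assumption).
  rewrite <- CSeries_scal by (apply disk_summable_at; assumption).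
  f_equal; [simpl; ring|].
  apply CSeries_ext; intros n; rewrite E; simpl; ring.
Qed.

Lemma CPSeries_0 (u : nat -> C) : disk_summable u -> CPSeries u 0 = u O.
Proof.
  intros Hu; assert (H0 : Cmod 0 < 1) by (rewrite Cmod_0; lra).
  unfold CPSeries; rewrite CSeries_incr_1 by (apply disk_summable_at; assumption).
  rewrite (CSeries_ext _ (fun n => 0 * (u n * 0 ^ n))%C) by (intros n; simpl; ring).
  rewrite CSeries_scal by (apply disk_summable_at; assumption).
  simpl; ring.
Qed.

(* The factor [rho] on the left avoids the exponent [n - 1] on the right. *)
Lemma pow_taylor2 (y z : C) (rho : R) (n : nat) :
  0 < rho -> Cmod y <= rho -> Cmod z <= rho ->
  rho * Cmod (y ^ S n - z ^ S n - RtoC (INR (S n)) * z ^ n * (y - z))%C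
  <= Cmod (y - z)%C ^ 2 * (INR (S n) * INR n * rho ^ n).
Proof.
  intros Hr Hy Hz.
  assert (Hh := Cmod_ge_0 (y - z)%C).
  induction n as [|n IH].
  { replace (y ^ 1 - z ^ 1 - RtoC (INR 1) * z ^ 0 * (y - z))%C with (RtoC 0)
      by (simpl; ring).
    rewrite Cmod_0; simpl; lra. }
  set (E := (y ^ S n - z ^ S n - RtoC (INR (S n)) * z ^ n * (y - z))%C) in *.
  replace (y ^ S (S n) - z ^ S (S n) - RtoC (INR (S (S n))) * z ^ S n * (y - z))%C
    with (y * E + RtoC (INR (S n)) * z ^ n * (y - z) ^ 2)%C.
  2:{ unfold E; rewrite (S_INR (S n)), RtoC_plus; simpl; ring. }
  assert (Hn : 0 <= INR (S n)) by apply pos_INR.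
  assert (Hpn : 0 <= rho ^ n) by (apply pow_le; lra).
  assert (Hzn : Cmod z ^ n <= rho ^ n) by (apply pow_incr; split; [apply Cmod_ge_0|exact Hz]).
  assert (Hh2 : 0 <= Cmod (y - z)%C ^ 2) by apply pow2_ge_0.
  assert (T : Cmod (y * E + RtoC (INR (S n)) * z ^ n * (y - z) ^ 2)%C
    <= rho * Cmod E + INR (S n) * rho ^ n * Cmod (y - z)%C ^ 2).
  { eapply Rle_trans; [apply Cmod_triangle|].
    rewrite !Cmod_mult, !Cmod_pow, Cmod_R, (Rabs_pos_eq _ Hn).
    apply Rplus_le_compat.
    - apply Rmult_le_compat_r; [apply Cmod_ge_0|exact Hy].
    - apply Rmult_le_compat_r; [exact Hh2|].
      apply Rmult_le_compat_l; assumption. }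
  apply Rmult_le_compat_l with (r := rho) in T; [|lra].
  eapply Rle_trans; [exact T|].
  apply Rmult_le_compat_l with (r := rho) in IH; [|lra].
  rewrite (S_INR (S n)); rewrite (S_INR n) in *; simpl (rho ^ S n).
  set (H2 := Cmod (y - z)%C ^ 2) in *; set (p := rho ^ n) in *; set (m := INR n) in *.
  replace (H2 * ((m + 1 + 1) * (m + 1) * (rho * p)))
    with (rho * (H2 * ((m + 1) * m * p)) + rho * ((m + 1) * p * H2)
          + rho * ((m + 1) * p * H2)) by ring.
  assert (0 <= rho * ((m + 1) * p * H2)) by (repeat apply Rmult_le_pos; lra).
  lra.
Qed.

(** The first-order remainder is summed termwise: by [pow_taylor2] on the disk of radius [rho],
    halfway between [|z|] and 1, it is at most a constant times [|y - z|^2]. The constant is finite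
    since twice-differentiated coefficients remain summable at [rho]. *)
Lemma is_derive_CPSeries (u : nat -> C) (z : C) :
  disk_summable u -> Cmod z < 1 ->
  Cderive_at (CPSeries u) z (CPSeries (CPS_derive u) z).
Proof.
  intros Hu Hz; assert (Hz0 := Cmod_ge_0 z).
  assert (Hd := disk_summable_derive u Hu).
  assert (Hnd := disk_summable_INR _ Hd).
  set (rho := (1 + Cmod z) / 2).
  assert (Hrho : 0 < rho < 1) by (unfold rho; lra).
  set (b := fun n => Cmod (u (S n)) * (INR (S n) * INR n * rho ^ n)).
  assert (Hb : ex_series b).
  { eapply ex_series_ext; [|exact (Hnd rho ltac:(lra))].
    intros n; unfold b, CPS_derive; cbv beta.
    rewrite !Cmod_mult, !Cmod_R, !Rabs_pos_eq by apply pos_INR.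
    Rring. }
  set (M := Series b).
  assert (Hb0 : forall n, 0 <= b n).
  { intros n; apply Rmult_le_pos; [apply Cmod_ge_0|].
    apply Rmult_le_pos; [|apply pow_le; lra].
    apply Rmult_le_pos; apply pos_INR. }
  assert (HM : 0 <= M).
  { apply Rle_trans with (Series (fun n => 0 * b n)).
    - rewrite Series_scal_l; lra.
    - apply Series_le; [|exact Hb]; intros n; specialize (Hb0 n); lra. }
  apply is_derive_C_eps; intros eps Heps.
  (* The first bound keeps [y] in the disk of radius [rho]; the [+ 1] covers [M = 0]. *)
  exists (Rmin (rho - Cmod z) (eps * rho / (2 * M + 1))); split.
  { apply Rmin_glb_lt; [unfold rho; lra|].
    apply Rdiv_lt_0_compat; [apply Rmult_lt_0_compat|]; lra. }
  intros y Hy.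
  assert (Hy1 : Cmod (y - z) < rho - Cmod z) by (eapply Rlt_le_trans; [apply Hy|apply Rmin_l]).
  assert (Hy2 : Cmod (y - z) < eps * rho / (2 * M + 1)) by (eapply Rlt_le_trans; [apply Hy|apply Rmin_r]).
  assert (Hyr : Cmod y <= rho).
  { assert (T := Cmod_lip y z); apply Rabs_le_between in T; lra. }
  assert (Hzr : Cmod z <= rho) by (unfold rho; lra).
  set (G := fun n => (u (S n) * (y ^ S n - z ^ S n - RtoC (INR (S n)) * z ^ n * (y - z)))%C).
  assert (HG : forall n, rho * Cmod (G n) <= Cmod (y - z)%C ^ 2 * b n).
  { intros n; unfold G, b; rewrite Cmod_mult.
    assert (T := pow_taylor2 y z rho n (proj1 Hrho) Hyr Hzr).
    apply Rmult_le_compat_l with (r := Cmod (u (S n))) in T; [|apply Cmod_ge_0].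
    lra. }
  assert (HG' : forall n, Cmod (G n) <= Cmod (y - z)%C ^ 2 / rho * b n).
  { intros n; replace (Cmod (y - z)%C ^ 2 / rho * b n)
      with (Cmod (y - z)%C ^ 2 * b n / rho) by (field; lra).
    apply Rle_div_r; [lra|]. rewrite Rmult_comm; apply HG. }
  assert (Hsc : ex_series (fun n => Cmod (y - z)%C ^ 2 / rho * b n))
    by exact (ex_series_scal_l _ _ Hb).
  assert (HGs : ex_series (fun n => Cmod (G n))).
  { apply ex_series_dominated with (2 := Hsc); intros n.
    rewrite Rabs_pos_eq by apply Cmod_ge_0; apply HG'. }
  assert (E : (CPSeries u y - CPSeries u z - (y - z) * CPSeries (CPS_derive u) z)%C
              = CSeries G).
  { assert (Sy := disk_summable_at u y Hu ltac:(lra)).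
    assert (Sz := disk_summable_at u z Hu ltac:(lra)).
    assert (Sd := disk_summable_at _ z Hd ltac:(lra)).
    assert (Sy' := proj1 (ex_series_incr_1 (K := R_AbsRing) (V := R_NormedModule) _) Sy).
    assert (Sz' := proj1 (ex_series_incr_1 (K := R_AbsRing) (V := R_NormedModule) _) Sz).
    unfold CPSeries.
    rewrite (CSeries_incr_1 _ Sy), (CSeries_incr_1 _ Sz).
    cbv beta in *.
    assert (Sd' : ex_series (fun n => Cmod ((y - z) * (CPS_derive u n * z ^ n)))).
    { eapply ex_series_ext; [|exact (ex_series_scal_l (Cmod (y - z)) _ Sd)].
      intros n; rewrite (Cmod_mult (y - z)); reflexivity. }
    assert (Sz'' : ex_series (fun n => Cmod ((- (1)) * (u (S n) * z ^ S n)))).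
    { eapply ex_series_ext; [|exact Sz'].
      intros n; rewrite (Cmod_mult (- (1))), Cmod_m1, Rmult_1_l; reflexivity. }
    rewrite (CSeries_ext G (fun n => u (S n) * y ^ S n
      + ((- (1)) * (u (S n) * z ^ S n) + (- (1)) * ((y - z) * (CPS_derive u n * z ^ n))))%C)
      by (intros n; unfold G, CPS_derive; ring).
    assert (Sd'' : ex_series (fun n => Cmod ((- (1)) * ((y - z) * (CPS_derive u n * z ^ n))))).
    { eapply ex_series_ext; [|exact Sd'].
      intros n; rewrite (Cmod_mult (- (1))), Cmod_m1, Rmult_1_l; reflexivity. }
    rewrite CSeries_plus, CSeries_plus; [|assumption|assumption|assumption|].
    - rewrite !CSeries_scal by assumption; simpl; ring.
    - eapply ex_series_dominated; [|exact (ex_series_plus _ _ Sz'' Sd'')].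
      intros n; rewrite Rabs_pos_eq by apply Cmod_ge_0; apply Cmod_triangle. }
  rewrite E.
  eapply Rle_trans; [apply (Cmod_CSeries_le G HGs)|].
  apply Rle_trans with (2 * (Cmod (y - z)%C ^ 2 / rho * M)).
  { apply Rmult_le_compat_l; [lra|].
    unfold M; rewrite <- Series_scal_l.
    apply Series_le; [|exact Hsc]; intros n; split; [apply Cmod_ge_0|apply HG']. }
  apply Rlt_div_r in Hy2; [|lra].
  assert (Hh := Cmod_ge_0 (y - z)%C).
  replace (2 * (Cmod (y - z)%C ^ 2 / rho * M))
    with (Cmod (y - z)%C * (Cmod (y - z)%C * (2 * M)) / rho) by (field; lra).
  apply Rle_div_l; [lra|].
  rewrite (Rmult_comm eps), Rmult_assoc.
  apply Rmult_le_compat_l; [exact Hh|]; lra.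
Qed.

(** * The hypergeometric equation *)

(** A ratio test for a limiting ratio at most 1: at radius [r] the ratio bound is taken at the
    midpoint [r'] of [r] and 1, so the tail is dominated by a geometric series of ratio [r / r']. *)
Lemma disk_summable_ratio (u : nat -> C) :
  (forall r, 0 < r < 1 -> exists N, forall n, (N <= n)%nat ->
    Cmod (u (S n)) * r <= Cmod (u n)) ->
  disk_summable u.
Proof.
  intros Hratio r Hr.
  set (r' := (1 + r) / 2).
  assert (Hr' : 0 < r' < 1) by (unfold r'; lra).
  destruct (Hratio r' Hr') as [N HN].
  assert (Hb : forall k, Cmod (u (N + k)%nat) * r' ^ k <= Cmod (u N)).
  { induction k as [|k IH].
    - rewrite Nat.add_0_r; simpl; lra.
    - rewrite Nat.add_succ_r; simpl.
      assert (T := HN (N + k)%nat ltac:(lia)).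
      apply Rmult_le_compat_r with (r := r' ^ k) in T; [|apply pow_le; lra].
      lra. }
  apply (ex_series_incr_n _ N).
  apply ex_series_dominated with (fun k => Cmod (u N) * r ^ N * (r / r') ^ k).
  - intros k; rewrite Rabs_pos_eq
      by (apply Rmult_le_pos; [apply Cmod_ge_0|apply pow_le; lra]).
    rewrite pow_add; unfold Rdiv; rewrite Rpow_mult_distr, pow_inv.
    assert (Hk : 0 < r' ^ k) by (apply pow_lt; lra).
    replace (Cmod (u (N + k)%nat) * (r ^ N * r ^ k))
      with (Cmod (u (N + k)%nat) * r' ^ k * (r ^ N * r ^ k / r' ^ k)) by (field; lra).
    replace (Cmod (u N) * r ^ N * (r ^ k * / r' ^ k))
      with (Cmod (u N) * (r ^ N * r ^ k / r' ^ k)) by (field; lra).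
    apply Rmult_le_compat_r; [|apply Hb].
    apply Rdiv_le_0_compat; [|exact Hk].
    apply Rmult_le_pos; apply pow_le; lra.
  - refine (ex_series_scal_l (K := R_AbsRing) (Cmod (u N) * r ^ N) (fun k => (r / r') ^ k) _).
    apply ex_series_geom; rewrite Rabs_pos_eq.
    + apply Rlt_div_l; unfold r' in *; lra.
    + apply Rdiv_le_0_compat; lra.
Qed.

Definition hypergeom_coef (a b c : C) (n : nat) : C :=
  (pochhammer a n * pochhammer b n / (pochhammer c n * RtoC (INR (fact n))))%C.

Lemma RtoC_INR_neq_0 (n : nat) : n <> O -> RtoC (INR n) <> 0%C.
Proof. intros Hn H; apply RtoC_inj in H; exact (not_0_INR n Hn H). Qed.

Lemma Re_pos_plus_INR (c : C) (n : nat) : 0 < Re c -> (c + RtoC (INR n) <> 0)%C.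
Proof.
  intros Hc H; apply (f_equal Re) in H; rewrite re_plus, !re_RtoC in H.
  assert (T := pos_INR n); lra.
Qed.

Lemma pochhammer_neq_0 (c : C) (n : nat) : 0 < Re c -> pochhammer c n <> 0%C.
Proof.
  intros Hc; induction n as [|n IH]; simpl.
  - apply C1_nz.
  - apply Cmult_neq_0; [exact IH|apply Re_pos_plus_INR, Hc].
Qed.

Lemma hypergeom_coef_S (a b c : C) (n : nat) :
  0 < Re c ->
  (RtoC (INR (S n)) * (c + RtoC (INR n)) * hypergeom_coef a b c (S n)
   = (a + RtoC (INR n)) * (b + RtoC (INR n)) * hypergeom_coef a b c n)%C.
Proof.
  intros Hc; unfold hypergeom_coef.
  rewrite fact_simpl, mult_INR, RtoC_mult; simpl pochhammer.
  field; repeat split;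
    [exact (RtoC_INR_neq_0 _ (fact_neq_0 n))|apply pochhammer_neq_0, Hc
    |exact (RtoC_INR_neq_0 (S n) (Nat.neq_succ_0 n))|apply Re_pos_plus_INR, Hc].
Qed.

Lemma disk_summable_hypergeom (a b c : C) :
  0 < Re c -> disk_summable (hypergeom_coef a b c).
Proof.
  intros Hc; apply disk_summable_ratio; intros r Hr.
  set (A := Cmod a + Cmod b + 1).
  assert (Ha := Cmod_ge_0 a); assert (Hb := Cmod_ge_0 b).
  (* For [x = n] beyond this threshold, [(1 - r) x^2 >= 3 A x >= 2 A x + A^2], whence
     [r (x + A)^2 <= x^2]. *)
  destruct (INR_unbounded (3 * A / (1 - r))) as [N HN].
  exists N; intros n Hn.
  apply le_INR in Hn.
  assert (HnA : 3 * A / (1 - r) < INR n) by lra.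
  apply Rlt_div_l in HnA; [|lra].
  assert (HA : 1 <= A) by (unfold A; lra).
  set (x := INR n) in *.
  assert (Hx0 : 0 <= x) by apply pos_INR.
  assert (HxA : A <= x) by nra.
  assert (E := f_equal Cmod (hypergeom_coef_S a b c n Hc)).
  rewrite !Cmod_mult, Cmod_R, Rabs_pos_eq in E by apply pos_INR.
  fold x in E.
  assert (Hnc : x <= Cmod (c + RtoC x)).
  { eapply Rle_trans; [|apply re_le_Cmod].
    rewrite re_plus, re_RtoC; eapply Rle_trans; [|apply Rle_abs]; lra. }
  assert (Hna : Cmod (a + RtoC x) <= x + A).
  { eapply Rle_trans; [apply Cmod_triangle|].
    rewrite Cmod_R, Rabs_pos_eq by exact Hx0; unfold A; lra. }
  assert (Hnb : Cmod (b + RtoC x) <= x + A).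
  { eapply Rle_trans; [apply Cmod_triangle|].
    rewrite Cmod_R, Rabs_pos_eq by exact Hx0; unfold A; lra. }
  rewrite S_INR in E; fold x in E.
  assert (T0 := Cmod_ge_0 (hypergeom_coef a b c n)).
  assert (T1 := Cmod_ge_0 (hypergeom_coef a b c (S n))).
  set (t0 := Cmod (hypergeom_coef a b c n)) in *.
  set (t1 := Cmod (hypergeom_coef a b c (S n))) in *.
  assert (L1 : x * x * t1 <= (x + A) * (x + A) * t0).
  { apply Rle_trans with ((x + 1) * Cmod (c + RtoC x) * t1).
    - apply Rmult_le_compat_r; [exact T1|]; apply Rmult_le_compat; lra.
    - rewrite E; apply Rmult_le_compat_r; [exact T0|].
      apply Rmult_le_compat; try apply Cmod_ge_0; assumption. }
  assert (L2 : (x + A) * (x + A) * r <= x * x) by nra.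
  apply Rmult_le_reg_l with (x * x); [nra|].
  apply Rle_trans with ((x + A) * (x + A) * r * t0).
  - apply Rmult_le_compat_r with (r := r) in L1; lra.
  - apply Rmult_le_compat_r; assumption.
Qed.

Lemma hypergeom_ode (a b z : C) :
  0 < Re (a + b + 1)%C -> Cmod z < 1 ->
  let t := hypergeom_coef a b (a + b + 1)%C in
  ((1 - z) * (z * CPSeries (CPS_derive (CPS_derive t)) z
              + (a + b + 1) * CPSeries (CPS_derive t) z)
   = a * b * CPSeries t z)%C.
Proof.
  intros Hc Hz t.
  assert (Ht : disk_summable t) by exact (disk_summable_hypergeom a b _ Hc).
  assert (Ht1 := disk_summable_derive t Ht).
  assert (Ht2 := disk_summable_derive _ Ht1).
  assert (Hn1 := disk_summable_INR _ Ht1).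
  assert (Hc1 := disk_summable_scal (a + b + 1)%C _ Ht1).
  assert (Hq := disk_summable_scal (- (a * b))%C _ Ht).
  set (v := fun n => (RtoC (INR n) * CPS_derive t n + (a + b + 1) * CPS_derive t n)%C).
  assert (Hv : disk_summable v) by exact (disk_summable_plus _ _ Hn1 Hc1).
  assert (Ev : forall n, v n = ((a + RtoC (INR n)) * (b + RtoC (INR n)) * t n)%C).
  { intros n; unfold t; rewrite <- hypergeom_coef_S by exact Hc.
    unfold v, CPS_derive; fold t; ring. }
  assert (E1 : (z * CPSeries (CPS_derive (CPS_derive t)) z
              + (a + b + 1) * CPSeries (CPS_derive t) z)%C = CPSeries v z).
  { unfold v; rewrite CPSeries_plus, CPSeries_scal by assumption.
    rewrite (CPSeries_incr_1 _ (CPS_derive (CPS_derive t)) z Hn1 Ht2 Hz (fun _ => eq_refl)).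
    simpl; ring. }
  rewrite E1.
  (* Here [c = a + b + 1] is decisive: [(a + n + 1) (b + n + 1) - a b = (n + 1) (n + c)], so
     [v - a b t] has zero constant term and is [v] shifted by one place. *)
  assert (E2 : CPSeries (fun n => v n + - (a * b) * t n)%C z = (z * CPSeries v z)%C).
  { rewrite (CPSeries_incr_1 _ v).
    - rewrite Ev; simpl; ring.
    - apply disk_summable_plus; assumption.
    - exact Hv.
    - exact Hz.
    - intros n; cbv beta; rewrite Ev; unfold v, CPS_derive.
      rewrite S_INR, RtoC_plus; ring. }
  rewrite CPSeries_plus, CPSeries_scal in E2 by assumption.
  replace ((1 - z) * CPSeries v z)%C with (CPSeries v z - z * CPSeries v z)%C by ring.
  rewrite <- E2; ring.
Qed.

(** * The boundary case and the conclusion *)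

Lemma Cmult_reg_r (x y k : C) : (x * k = y * k)%C -> k <> 0%C -> x = y.
Proof.
  intros H Hk; replace x with (x * k / k)%C by (field; exact Hk).
  rewrite H; field; exact Hk.
Qed.

(** With [x = F z], [y = z F'] and [k = e^(-i la)], the right side is [4 c |F|^2] times
    [Re (k (1 + z F' / F))] wherever [F] does not vanish. This converts spirallikeness into a
    comparison of moduli without dividing by [F]. *)
Lemma Cmod_sum_lt (x y k : C) (c : R) :
  0 < c -> Cmod k = 1 ->
  Cmod (2 * c * x + k * y)%C ^ 2 - Cmod y ^ 2
  = 4 * c * (c * Cmod x ^ 2 + Re (k * y * Cconj x)%C).
Proof.
  intros Hc Hk.
  replace (Cmod y ^ 2) with (Cmod (k * y)%C ^ 2) by (rewrite Cmod_mult, Hk, Rmult_1_l; reflexivity).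
  set (y' := (k * y)%C).
  rewrite !Cmod2_alt; unfold Re, Im, Cconj; simpl; ring.
Qed.

(* [P] and [Q] stand for [F z0] and [z0 F'(z0)]; the case [P = 0] is a zero of [F], where
   [z F' / F] has a pole. *)
Lemma boundary_contradiction (la q k : R) (s P Q tau : C) :
  let kap := cis (- la) in
  let D := (2 * cos la * P + kap * Q)%C in
  let Q' := (- s * Q + tau * P)%C in
  let D' := (2 * cos la * Q + kap * Q')%C in
  0 < cos la -> 0 < 4 * cos la ^ 2 - 1 ->
  (Im (cis la * s)%C - sin la) ^ 2 <= (4 * cos la ^ 2 - 1) * (2 * Re s - 1 - q) ->
  Cmod D = Cmod Q -> Q <> 0%C -> 0 <= k ->
  - (q / 2) < Re tau ->
  (Q' * D - Q * D' = (1 + k) * Q * D)%C -> False.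
Proof.
  intros kap D Q' D' Hc Hm Hcond HD HQ Hk Htau E.
  assert (Hsc := sin2_cos2 la); unfold Rsqr in Hsc.
  assert (Hkap : kap = (cos la, - sin la)) by (unfold kap, cis; rewrite cos_neg, sin_neg; reflexivity).
  assert (Hkm : Cmod kap = 1).
  { unfold kap, cis, Cmod; simpl fst; simpl snd; rewrite cos_neg, sin_neg.
    rewrite <- sqrt_1; f_equal; lra. }
  assert (H0 : cos la * Cmod P ^ 2 + Re (kap * Q * Cconj P)%C = 0).
  { assert (T := Cmod_sum_lt P Q kap (cos la) Hc Hkm).
    fold D in T; rewrite HD in T; nra. }
  destruct (Ceq_dec P 0) as [HP|HP].
  - assert (E' : ((1 + k) * kap = - (2 * cos la))%C).
    { apply Cmult_reg_r with (Q * Q)%C; [|apply Cmult_neq_0; exact HQ].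
      transitivity ((1 + k) * Q * D)%C.
      - unfold D; rewrite HP; ring.
      - rewrite <- E; unfold Q', D', D, Q'; rewrite HP; ring. }
    (* The real parts are [(1 + k) * cos la > 0] and [- 2 * cos la < 0]. *)
    apply (f_equal Re) in E'; rewrite Hkap in E'; unfold Re in E'; simpl in E'.
    nra.
  - set (w := (Q / P)%C).
    assert (EQ : Q = (w * P)%C) by (unfold w; field; exact HP).
    assert (Hu : Re (kap * w)%C = - cos la).
    { assert (HPm : 0 < Cmod P ^ 2) by (apply pow_lt, Cmod_gt_0, HP).
      apply Rmult_eq_reg_r with (Cmod P ^ 2); [|lra].
      replace (Re (kap * w) * Cmod P ^ 2) with (Re (kap * Q * Cconj P)%C); [lra|].
      rewrite <- re_scal_r; f_equal.
      rewrite Cmod2_conj, EQ; ring. }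
    (* The products [kap * Q * Q'] cancel in [Q' * D - Q * D'], leaving
       [2 * cos la * (Q' * P - Q * Q)]. *)
    assert (Ew : (2 * cos la * (- s * w + tau - w * w) = (1 + k) * (w * (2 * cos la + kap * w)))%C).
    { apply Cmult_reg_r with (P * P)%C; [|apply Cmult_neq_0; exact HP].
      transitivity ((1 + k) * Q * D)%C.
      - rewrite <- E; unfold D', D, Q'; rewrite EQ; ring.
      - unfold D; rewrite EQ; ring. }
    rewrite Hkap in Ew, Hu.
    clearbody w; clear - Ew Hu Hc Hm Hcond Hk Htau Hsc.
    destruct w as [w1 w2], s as [s1 s2], tau as [t1 t2].
    apply (f_equal Re) in Ew.
    unfold Re, Im, cis in *; simpl in Ew, Hu, Hcond, Htau.
    set (c := cos la) in *; set (S := sin la) in *; clearbody c S.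
    (* [v] is the imaginary part of [kap * w]; it parametrises the boundary line as
       [w = e^(i la) (- c + i v)]. *)
    assert (Hv : exists v, v = c * w2 - S * w1) by (eexists; reflexivity).
    destruct Hv as [v Hv].
    assert (W1 : w1 = - c * c - S * v) by (clear - Hv Hu Hsc; nsatz).
    assert (W2 : w2 = - c * S + c * v) by (clear - Hv Hu Hsc; nsatz).
    rewrite Hu in Ew; replace (c * w2 + - S * w1) with v in Ew by lra.
    clear Hv Hu; subst w1 w2.
    (* On this line [w (2 c + kap w) = - e^(i la) (c^2 + v^2)], whose real part is
       [- c (c^2 + v^2)]. *)
    assert (ER : c * (- (s1 * (- c * c - S * v) - s2 * (- c * S + c * v)) + t1
                 - ((- c * c - S * v) ^ 2 - (- c * S + c * v) ^ 2)) * 2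
                 = - (1 + k) * c * (c * c + v * v)).
    { clear - Ew; lra. }
    assert (ER2 : 2 * t1 = 2 * (s1 * (- c * c - S * v) - s2 * (- c * S + c * v)
                 + ((- c * c - S * v) ^ 2 - (- c * S + c * v) ^ 2)) - (1 + k) * (c * c + v * v)).
    { apply Rmult_eq_reg_l with c; lra. }
    set (Y := c * s2 + S * s1).
    (* Completing the square in [v]: what remains beside the square is the difference of the two
       sides of [Hcond]. The part of [2 * t1] carrying [k] is nonpositive and is left out here. *)
    assert (Key : (4 * (c * c) - 1) * (2 * (s1 * (- c * c - S * v) - s2 * (- c * S + c * v)
                 + ((- c * c - S * v) ^ 2 - (- c * S + c * v) ^ 2)) - (c * c + v * v) + q)
       = - ((4 * (c * c) - 1) * (v - S) - (S - Y)) ^ 2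
         + ((Y - S) ^ 2 - (4 * (c * c) - 1) * (2 * s1 - 1 - q))).
    { assert (E1 : - c * c - S * v = - 1 - S * (v - S)) by (clear - Hsc; nsatz).
      rewrite E1; unfold Y; clear - Hsc.
      replace (c * c) with (1 - S * S) by lra.
      replace ((- c * S + c * v) ^ 2) with ((1 - S * S) * (v - S) ^ 2) by (rewrite <- Hsc; ring).
      ring. }
    assert (Hm' : 0 < 4 * (c * c) - 1) by lra.
    assert (Hcond' : (Y - S) ^ 2 - (4 * (c * c) - 1) * (2 * s1 - 1 - q) <= 0) by (unfold Y; lra).
    assert (Hsq := pow2_ge_0 ((4 * (c * c) - 1) * (v - S) - (S - Y))).
    assert (0 <= k * (c * c + v * v)) by (apply Rmult_le_pos; nra).
    nra.
Qed.

Lemma pow2_minus_le_0 (x y : R) : 0 <= x -> 0 <= y -> x ^ 2 - y ^ 2 <= 0 <-> x <= y.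
Proof.
  intros Hx Hy; split; intros H.
  - apply Rnot_lt_le; intros H'; nra.
  - assert (T := pow_incr x y 2 (conj Hx H)); lra.
Qed.

(** * From the differential equation to spirallikeness *)

Section HypergeometricEquation.
Variables (F F1 F2 : C -> C) (s : C) (q : R).
Hypothesis F_derive : forall z, Cmod z < 1 -> Cderive_at F z (F1 z).
Hypothesis F1_derive : forall z, Cmod z < 1 -> Cderive_at F1 z (F2 z).
Hypothesis F_0 : F 0 = 1.
Hypothesis ode : forall z, Cmod z < 1 ->
  ((1 - z) * (z * F2 z + (s + 1) * F1 z) = q * F z)%C.

Lemma one_minus_neq_0 (z : C) : Cmod z < 1 -> (1 - z)%C <> 0%C.
Proof.
  intros Hz H; assert (E : z = 1%C) by (transitivity (1 - (1 - z))%C; [ring|rewrite H; ring]).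
  rewrite E, Cmod_1 in Hz; lra.
Qed.

(** The equation in terms of [Q = z F']: its Euler derivative is [- s Q + tau F] with
    [tau = q z / (1 - z)], so the pair [(F, Q)] solves a linear first-order system. *)
Lemma euler_derivative (z : C) : Cmod z < 1 ->
  (z * (F1 z + z * F2 z) = - s * (z * F1 z) + q * z / (1 - z) * F z)%C.
Proof.
  intros Hz; assert (H1 := one_minus_neq_0 z Hz).
  replace (q * z / (1 - z) * F z)%C with (z * (q * F z) / (1 - z))%C by (field; exact H1).
  rewrite <- ode by exact Hz; field; exact H1.
Qed.

Lemma is_derive_euler (z : C) : Cmod z < 1 ->
  Cderive_at (fun z => z * F1 z)%C z (F1 z + z * F2 z)%C.
Proof.
  intros Hz.
  refine (is_derive_C_ext _ _ _ _ _ (fun _ => eq_refl) _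
    (is_derive_C_mult _ _ _ _ _ (is_derive_C_id z) (F1_derive z Hz))); cbv beta; ring.
Qed.

Lemma Re_mult_conj_le (x y : C) : Rabs (Re (x * Cconj y)%C) <= Cmod x * Cmod y.
Proof.
  eapply Rle_trans; [apply re_le_Cmod|].
  rewrite Cmod_mult, Cmod_conj; apply Rle_refl.
Qed.

(* Along the ray through [z0], [E = |F|^2 + |z F'|^2] satisfies [|t E'| <= L E], so
   [t^K E] is nondecreasing for [K >= L] and cannot vanish at [t = 1]. *)
Lemma no_common_zero (z0 : C) :
  Cmod z0 < 1 -> F z0 = 0%C -> (z0 * F1 z0)%C <> 0%C.
Proof.
  intros Hz0 HF HQ.
  assert (Hm := Cmod_ge_0 z0).
  assert (Hin : forall t : R, 0 <= t <= 1 -> Cmod (0 + t * z0)%C < 1).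
  { intros t Ht; rewrite Cplus_0_l, Cmod_mult, Cmod_R, Rabs_pos_eq by lra; nra. }
  set (T := q / (1 - Cmod z0)).
  set (E := fun t : R => Cmod (F (0 + t * z0)%C) ^ 2
     + Cmod ((0 + t * z0) * F1 (0 + t * z0))%C ^ 2).
  set (E' := fun t : R => 2 * Re (F1 (0 + t * z0) * z0 * Cconj (F (0 + t * z0)))%C
     + 2 * Re ((F1 (0 + t * z0) + (0 + t * z0) * F2 (0 + t * z0)) * z0
               * Cconj ((0 + t * z0) * F1 (0 + t * z0)))%C).
  assert (HE : forall t, 0 <= t <= 1 -> is_derive E t (E' t)).
  { intros t Ht; specialize (Hin t Ht).
    apply (is_derive_plus (V := R_NormedModule)).
    - apply is_derive_Cmod2_line, F_derive, Hin.
    - apply (is_derive_Cmod2_line (fun z => z * F1 z)%C), is_derive_euler, Hin. }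
  assert (HE0 : forall t, 0 <= E t).
  { intros t; unfold E; assert (A1 := pow2_ge_0 (Cmod (F (0 + t * z0)%C)));
    assert (A2 := pow2_ge_0 (Cmod ((0 + t * z0) * F1 (0 + t * z0))%C)); lra. }
  (* With [p = |F|] and [x = |z F'|], [|t E'| <= 2 p x + 2 |s| x^2 + 2 |T| p x]; then
     [2 p x <= p^2 + x^2]. [T] bounds [|q z / (1 - z)|] along the segment. *)
  set (L := 1 + Rabs T + 2 * Cmod s).
  assert (Hgrow : forall t, 0 <= t <= 1 -> Rabs (t * E' t) <= L * E t).
  { intros t Ht; specialize (Hin t Ht).
    set (z := (0 + t * z0)%C) in *.
    set (P := F z); set (Q := (z * F1 z)%C).
    set (tau := (q * z / (1 - z))%C).
    assert (Htau : Cmod tau <= Rabs T).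
    { assert (H1 := one_minus_neq_0 z Hin).
      assert (Hz1 : Cmod z <= Cmod z0).
      { unfold z; rewrite Cplus_0_l, Cmod_mult, Cmod_R, Rabs_pos_eq by lra; nra. }
      assert (Hd : 1 - Cmod z0 <= Cmod (1 - z)%C).
      { assert (A := Cmod_lip 1 z); rewrite Cmod_1 in A; apply Rabs_le_between in A; lra. }
      unfold tau, T; rewrite Cmod_div, Cmod_mult, Cmod_R by exact H1.
      rewrite Rabs_div, (Rabs_pos_eq (1 - Cmod z0)) by lra.
      apply Rle_div_l; [lra|].
      unfold Rdiv; rewrite Rmult_assoc; apply Rmult_le_compat_l; [apply Rabs_pos|].
      apply Rle_trans with 1; [lra|].
      apply Rmult_le_reg_l with (1 - Cmod z0); [lra|].
      rewrite <- Rmult_assoc, Rinv_r by lra; lra. }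
    assert (Eq : t * E' t = 2 * Re (Q * Cconj P)%C + 2 * Re ((- s * Q + tau * P) * Cconj Q)%C).
    { unfold E'; fold z; rewrite Rmult_plus_distr_l, <- !Rmult_assoc, !(Rmult_comm t 2), !Rmult_assoc.
      rewrite <- !re_scal_l; f_equal; f_equal; f_equal.
      - unfold Q, P, z; ring.
      - unfold Q, tau, P; rewrite <- euler_derivative by exact Hin; unfold z; ring. }
    rewrite Eq.
    assert (A1 := Re_mult_conj_le Q P).
    assert (A2 := Re_mult_conj_le (- s * Q + tau * P) Q).
    assert (A3 : Cmod (- s * Q + tau * P)%C <= Cmod s * Cmod Q + Rabs T * Cmod P).
    { eapply Rle_trans; [apply Cmod_triangle|].
      rewrite !Cmod_mult, Cmod_opp; apply Rplus_le_compat_l, Rmult_le_compat_r;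
        [apply Cmod_ge_0|exact Htau]. }
    unfold E; fold z; fold Q; fold P.
    assert (Hs := Cmod_ge_0 s); assert (HT := Rabs_pos T).
    assert (HP := Cmod_ge_0 P); assert (HQ' := Cmod_ge_0 Q).
    set (p := Cmod P) in *; set (x := Cmod Q) in *; set (sg := Cmod s) in *; set (T' := Rabs T) in *.
    apply Rmult_le_compat_r with (r := x) in A3; [|exact HQ'].
    assert (Hsq : 2 * (p * x) <= p ^ 2 + x ^ 2) by (assert (A := pow2_ge_0 (p - x)); lra).
    assert (B1 : T' * (2 * (p * x)) <= T' * (p ^ 2 + x ^ 2)) by (apply Rmult_le_compat_l; lra).
    assert (B2 : 0 <= sg * p ^ 2) by (apply Rmult_le_pos; [lra|apply pow2_ge_0]).
    apply Rabs_le_between in A1, A2.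
    apply Rabs_le; unfold L; lra. }
  destruct (INR_unbounded L) as [K HK].
  set (g := fun t => t ^ S K * E t).
  assert (Hg : forall t, 0 <= t <= 1 ->
    is_derive g t (INR (S K) * t ^ K * E t + t ^ S K * E' t)).
  { intros t Ht.
    evar_last.
    - apply (is_derive_mult (fun t => t ^ S K) E t (INR (S K) * 1 * t ^ pred (S K)) (E' t)).
      + apply (is_derive_pow (fun t => t)), (is_derive_id (K := R_AbsRing)).
      + apply HE, Ht.
      + apply Rmult_comm.
    - unfold plus, mult; simpl; unfold mult; simpl; ring. }
  assert (Hmono : forall x, 0 < x < 1 -> g x <= g 1).
  { intros x Hx.
    destruct (MVT_cor2 g (fun t => INR (S K) * t ^ K * E t + t ^ S K * E' t) x 1 (proj2 Hx))
      as [c [Ec Hc]].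
    - intros t Ht; apply is_derive_Reals, Hg; lra.
    - assert (Hct := Hgrow c ltac:(lra)); apply Rabs_le_between in Hct.
      assert (Hck : 0 <= c ^ K) by (apply pow_le; lra).
      assert (HEc := HE0 c).
      assert (0 <= c ^ K * (INR (S K) * E c + c * E' c)).
      { apply Rmult_le_pos; [exact Hck|].
        assert (L * E c <= INR (S K) * E c).
        { apply Rmult_le_compat_r; [exact HEc|]; rewrite S_INR; lra. }
        lra. }
      assert (0 <= (INR (S K) * c ^ K * E c + c ^ S K * E' c) * (1 - x)).
      { apply Rmult_le_pos; [|lra]; simpl (c ^ S K); lra. }
      lra. }
  assert (Hg1 : g 1 = 0).
  { unfold g, E; replace (0 + 1 * z0)%C with z0 by ring.
    rewrite HF, HQ, Cmod_0; ring. }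
  (* Near the origin [F] is close to 1, so [g] is positive there, whereas monotonicity would give
     [g x <= g 1 = 0]. *)
  destruct (is_derive_C_cont F 0 _ (F_derive 0 ltac:(rewrite Cmod_0; lra)) 1 Rlt_0_1)
    as [d [Hd Hcont]].
  set (x := Rmin (1 / 2) (d / 2)).
  assert (Hx1 : x <= 1 / 2) by apply Rmin_l.
  assert (Hx2 : x <= d / 2) by apply Rmin_r.
  assert (Hx0 : 0 < x) by (apply Rmin_glb_lt; lra).
  assert (HFx : F (0 + x * z0)%C <> 0%C).
  { intros H; specialize (Hcont (0 + x * z0)%C).
    rewrite H, F_0 in Hcont.
    replace (0 + x * z0 - 0)%C with (x * z0)%C in Hcont by ring.
    replace (0 - 1)%C with (- (1))%C in Hcont by ring.
    rewrite Cmod_m1, Cmod_mult, Cmod_R, Rabs_pos_eq in Hcont by lra.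
    specialize (Hcont ltac:(nra)); lra. }
  assert (Hgx : 0 < g x).
  { unfold g, E; apply Rmult_lt_0_compat; [apply pow_lt, Hx0|].
    apply Rplus_lt_le_0_compat; [apply pow_lt, Cmod_gt_0, HFx|apply pow2_ge_0]. }
  specialize (Hmono x ltac:(lra)); lra.
Qed.

Variable la : R.
Hypothesis F2_derive : forall z, Cmod z < 1 -> exists l, Cderive_at F2 z l.
Hypothesis q_pos : 0 < q.
Hypothesis cos_pos : 0 < cos la.
Hypothesis cos_large : 0 < 4 * cos la ^ 2 - 1.
Hypothesis parabola :
  (Im (cis la * s)%C - sin la) ^ 2 <= (4 * cos la ^ 2 - 1) * (2 * Re s - 1 - q).

Let kap := cis (- la).
Let D z := (2 * cos la * F z + kap * (z * F1 z))%C.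
Let D1 z := (2 * cos la * F1 z + kap * (F1 z + z * F2 z))%C.

Lemma Cmod_cis (t : R) : Cmod (cis t) = 1.
Proof.
  unfold cis, Cmod; simpl fst; simpl snd.
  rewrite <- sqrt_1; f_equal; assert (H := sin2_cos2 t); unfold Rsqr in H; lra.
Qed.

Lemma D_derive (z : C) : Cmod z < 1 -> Cderive_at D z (D1 z).
Proof.
  intros Hz; unfold D, D1; apply is_derive_C_plus.
  - apply is_derive_C_scal, F_derive, Hz.
  - apply is_derive_C_scal, is_derive_euler, Hz.
Qed.

Lemma D1_derive (z : C) : Cmod z < 1 -> exists l, Cderive_at D1 z l.
Proof.
  intros Hz; destruct (F2_derive z Hz) as [l Hl]; eexists.
  unfold D1; apply is_derive_C_plus; apply is_derive_C_scal.
  - apply F1_derive, Hz.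
  - apply is_derive_C_plus; [apply F1_derive, Hz|].
    apply is_derive_C_mult; [apply is_derive_C_id|exact Hl].
Qed.

(** After multiplication by [|1 - z|^2] the gap between the two sides is [q (1 - |z|^2) / 2]. That
    [q] is real and positive is essential here. *)
Lemma Re_mobius (z : C) : Cmod z < 1 -> - (q / 2) < Re (q * z / (1 - z))%C.
Proof.
  intros Hz; assert (H1 := one_minus_neq_0 z Hz).
  assert (Hn : 0 < Cmod (1 - z)%C ^ 2) by (apply pow_lt, Cmod_gt_0, H1).
  assert (Hz2 : Cmod z ^ 2 < 1).
  { assert (A := Cmod_ge_0 z); nra. }
  apply Rmult_lt_reg_r with (Cmod (1 - z)%C ^ 2); [exact Hn|].
  rewrite <- re_scal_r, Cmod2_conj.
  replace (q * z / (1 - z) * ((1 - z) * Cconj (1 - z)))%C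
    with (q * (z * Cconj (1 - z)))%C by (field; exact H1).
  rewrite re_scal_l.
  rewrite Cmod2_alt in Hn, Hz2 |- *.
  destruct z as [x y]; unfold Re, Im, Cconj in *; simpl in *.
  nra.
Qed.

Lemma euler_lt (z : C) : Cmod z < 1 -> Cmod (z * F1 z)%C < Cmod (D z).
Proof.
  intros Hz; apply Rnot_le_lt; intros Hbad.
  set (h := fun x => Cmod (D x) ^ 2 - Cmod (x * F1 x)%C ^ 2).
  assert (Hh : forall x, Cmod x < 1 -> Ccontinuous h x).
  { intros x Hx.
    apply (continuous_minus (U := AbsRing_UniformSpace C_AbsRing) (V := R_NormedModule)).
    - exact (Ccontinuous_Cmod2 _ _ _ (D_derive x Hx)).
    - exact (Ccontinuous_Cmod2 (fun x => x * F1 x)%C _ _ (is_derive_euler x Hx)). }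
  assert (Hsgn : forall x, h x <= 0 <-> Cmod (D x) <= Cmod (x * F1 x)%C).
  { intros x; apply pow2_minus_le_0; apply Cmod_ge_0. }
  (* A closed set, so [- Cmod x] attains its maximum on it, which gives a bad point of least
     modulus. *)
  set (bad := fun x => Cmod x <= Cmod z /\ h x <= 0).
  destruct (continuous_max bad (Cmod z) (fun _ H => proj1 H)) with
    (f := fun x => - Cmod x) (p0 := z) as [z0 [[Hz0 Hh0] Hmin]].
  { intros p Hp; destruct (Rle_lt_dec (Cmod p) (Cmod z)) as [Hle|Hgt].
    - assert (Hpos : 0 < h p).
      { apply Rnot_le_lt; intros H; apply Hp; split; assumption. }
      destruct (proj1 (Ccontinuous_eps _ _) (Hh p ltac:(lra)) (h p) Hpos) as [d [Hd H]].
      exists d; split; [exact Hd|]; intros y Hy [_ Hy2].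
      specialize (H y Hy); apply Rabs_def2 in H; lra.
    - destruct (closed_disk_compl (Cmod z) p ltac:(lra)) as [d [Hd H]].
      exists d; split; [exact Hd|]; intros y Hy [Hy1 _]; exact (H y Hy Hy1). }
  { split; [apply Rle_refl|]; apply Hsgn, Hbad. }
  { intros p _; apply (continuous_opp (U := AbsRing_UniformSpace C_AbsRing) (V := R_NormedModule)).
    exact (Ccontinuous_Cmod (fun x => x) _ _ (is_derive_C_id p)). }
  assert (Hz01 : Cmod z0 < 1) by lra.
  assert (Hgood : forall x, Cmod x < Cmod z0 -> 0 < h x).
  { intros x Hx; apply Rnot_le_lt; intros H.
    assert (T := Hmin x (conj (Rle_trans _ _ _ (Rlt_le _ _ Hx) Hz0) H)); lra. }
  assert (Hr : 0 < Cmod z0).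
  { destruct (Rle_lt_or_eq_dec _ _ (Cmod_ge_0 z0)) as [H|H]; [exact H|exfalso].
    symmetry in H; apply Cmod_eq_0 in H.
    rewrite H in Hh0; apply Hsgn in Hh0.
    unfold D in Hh0; rewrite F_0 in Hh0.
    replace (2 * cos la * 1 + kap * (0 * F1 0))%C with (RtoC (2 * cos la)) in Hh0
      by (rewrite RtoC_mult; ring).
    rewrite Cmult_0_l, Cmod_0, Cmod_R, Rabs_pos_eq in Hh0; lra. }
  (* The strict inequality inside passes to the closed disk by moving [x] slightly towards the
     origin. *)
  assert (Hnn : forall x, Cmod x <= Cmod z0 -> 0 <= h x).
  { intros x Hx; apply Rnot_lt_le; intros Hneg.
    destruct (proj1 (Ccontinuous_eps _ _) (Hh x ltac:(lra)) (- h x) ltac:(lra)) as [d [Hd H]].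
    set (e := Rmin (1 / 2) (d / 2)).
    assert (He1 : e <= 1 / 2) by apply Rmin_l.
    assert (He2 : e <= d / 2) by apply Rmin_r.
    assert (He0 : 0 < e) by (apply Rmin_glb_lt; lra).
    assert (Hxm := Cmod_ge_0 x).
    assert (Hy : Cmod ((1 - e)%R * x)%C < Cmod z0).
    { rewrite Cmod_mult, Cmod_R, Rabs_pos_eq by lra; nra. }
    specialize (H ((1 - e)%R * x)%C).
    replace ((1 - e)%R * x - x)%C with ((- e)%R * x)%C in H
      by (rewrite RtoC_minus, RtoC_opp; ring).
    rewrite Cmod_mult, Cmod_R, Rabs_Ropp, Rabs_pos_eq in H by lra.
    specialize (H ltac:(nra)); apply Rabs_def2 in H.
    specialize (Hgood _ Hy); lra. }
  (* If [D x = 0], then [0 <= h x] forces [x F1 x = 0], hence [F x = 0], against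
     [no_common_zero]. *)
  assert (HDnz : forall x, Cmod x <= Cmod z0 -> D x <> 0%C).
  { intros x Hx HD.
    assert (Hx' := Hnn x Hx); unfold h in Hx'; rewrite HD, Cmod_0 in Hx'.
    assert (HQ : (x * F1 x)%C = 0%C).
    { apply Cmod_eq_0; assert (A := Cmod_ge_0 (x * F1 x)%C); nra. }
    apply (no_common_zero x); [lra| |exact HQ].
    unfold D in HD; rewrite HQ in HD.
    apply Cmult_reg_r with (RtoC (2 * cos la)).
    - rewrite RtoC_mult, Cmult_0_l, <- HD; ring.
    - intros H; apply RtoC_inj in H; lra. }
  assert (Heq : Cmod (D z0) = Cmod (z0 * F1 z0)%C).
  { assert (A := Hnn z0 (Rle_refl _)); unfold h in A, Hh0.
    assert (B := Cmod_ge_0 (D z0)); assert (B' := Cmod_ge_0 (z0 * F1 z0)%C).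
    apply Rle_antisym; apply Rnot_lt_le; intros H; nra. }
  assert (HQ0 : (z0 * F1 z0)%C <> 0%C).
  { apply Cmod_gt_0; rewrite <- Heq; apply Cmod_gt_0, HDnz, Rle_refl. }
  set (psi := fun x => (F1 x / D x)%C).
  set (psi' := fun x => ((F2 x * D x - F1 x * D1 x) / (D x * D x))%C).
  assert (Hpsi : forall x, Cmod x <= Cmod z0 -> Cderive_at psi x (psi' x)).
  { intros x Hx; apply is_derive_C_div.
    - apply HDnz, Hx.
    - apply F1_derive; lra.
    - apply D_derive; lra. }
  assert (Hpsi' : forall x, Cmod x < Cmod z0 -> exists l, Cderive_at psi' x l).
  { intros x Hx.
    assert (Hx1 : Cmod x < 1) by lra.
    destruct (F2_derive x Hx1) as [l2 H2]; destruct (D1_derive x Hx1) as [l1 H1].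
    assert (HD0 : D x <> 0%C) by (apply HDnz; lra).
    eexists; apply is_derive_C_div.
    - apply Cmult_neq_0; exact HD0.
    - apply is_derive_C_minus; apply is_derive_C_mult;
        [exact H2|apply D_derive, Hx1|apply F1_derive, Hx1|exact H1].
    - apply is_derive_C_mult; apply D_derive, Hx1. }
  assert (Habs : forall x, Cmod x <= Cmod z0 ->
    Cmod x * Cmod (psi x) = Cmod (x * F1 x)%C / Cmod (D x)).
  { intros x Hx; unfold psi; rewrite Cmod_div, Cmod_mult by (apply HDnz, Hx).
    unfold Rdiv; ring. }
  assert (Hpsi0 : Cmod (psi z0) = / Cmod z0).
  { apply Rmult_eq_reg_l with (Cmod z0); [|lra].
    rewrite Habs, Rinv_r by lra.
    rewrite Heq; field; apply Rgt_not_eq, Cmod_gt_0, HQ0. }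
  assert (Hmax : forall x, Cmod x <= Cmod z0 -> Cmod (psi x) <= Cmod (psi z0)).
  { apply (maximum_modulus psi psi' (Cmod z0) Hr Hpsi _ Hpsi').
    intros x Hx; rewrite Hpsi0.
    apply Rmult_le_reg_l with (Cmod z0); [exact Hr|].
    rewrite Rinv_r, <- Hx at 1 by lra; rewrite Habs by lra.
    assert (HDx : 0 < Cmod (D x)) by (apply Cmod_gt_0, HDnz; lra).
    apply Rle_div_l; [exact HDx|].
    assert (A := Hnn x ltac:(lra)); unfold h in A.
    assert (B := Cmod_ge_0 (x * F1 x)%C).
    apply Rnot_lt_le; intros H; nra. }
  destruct (boundary_max_derivative psi psi' (Cmod z0) Hr Hpsi z0 eq_refl) as [k [Hk Ek]].
  { apply Cmod_gt_0; rewrite Hpsi0; apply Rinv_0_lt_compat, Hr. }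
  { exact Hmax. }
  apply (boundary_contradiction la q k s (F z0) (z0 * F1 z0)%C (q * z0 / (1 - z0))%C);
    try assumption.
  - apply Re_mobius, Hz01.
  - rewrite <- euler_derivative by exact Hz01.
    change (2 * cos la * F z0 + cis (- la) * (z0 * F1 z0))%C with (D z0).
    replace (2 * cos la * (z0 * F1 z0) + cis (- la) * (z0 * (F1 z0 + z0 * F2 z0)))%C
      with (z0 * D1 z0)%C by (unfold D1, kap; ring).
    assert (HD0 := HDnz z0 (Rle_refl _)).
    unfold psi, psi' in Ek.
    (* Denominators are cleared; since [Q = z F1], the product rule contributes an extra [Q D],
       turning [k] into [1 + k]. *)
    apply (f_equal (fun x => x * (z0 * D z0 * D z0))%C) in Ek.
    replace (z0 * ((F2 z0 * D z0 - F1 z0 * D1 z0) / (D z0 * D z0)) * (z0 * D z0 * D z0))%C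
      with (z0 * z0 * (F2 z0 * D z0 - F1 z0 * D1 z0))%C in Ek by (field; exact HD0).
    replace (k * (F1 z0 / D z0) * (z0 * D z0 * D z0))%C
      with (k * (z0 * F1 z0) * D z0)%C in Ek by (field; exact HD0).
    transitivity (z0 * z0 * (F2 z0 * D z0 - F1 z0 * D1 z0) + z0 * F1 z0 * D z0)%C; [ring|].
    rewrite Ek; ring.
Qed.

Lemma spirallike_of_ode : - (PI / 2) < la < PI / 2 ->
  spirallike la (fun z => z * F z)%C.
Proof.
  intros Hla.
  assert (Hf : forall z, Cmod z < 1 -> Cderive_at (fun z => z * F z)%C z (F z + z * F1 z)%C).
  { intros z Hz.
    refine (is_derive_C_ext _ _ _ _ _ (fun _ => eq_refl) _
      (is_derive_C_mult _ _ _ _ _ (is_derive_C_id z) (F_derive z Hz))); cbv beta; ring. }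
  assert (Hf' : forall z : C, Cmod z < 1 ->
    C_derive (fun z : C => z * F z)%C z = (F z + z * F1 z)%C).
  { intros z Hz; apply is_C_derive_unique, Hf, Hz. }
  assert (H0 : Cmod 0 < 1) by (rewrite Cmod_0; lra).
  assert (Hpos : forall z, Cmod z < 1 ->
    0 < cos la * Cmod (F z) ^ 2 + Re (kap * (z * F1 z) * Cconj (F z))%C).
  { intros z Hz; assert (A := euler_lt z Hz).
    assert (B := Cmod_sum_lt (F z) (z * F1 z) kap (cos la) cos_pos (Cmod_cis (- la))).
    fold (D z) in B; assert (A' := Cmod_ge_0 (z * F1 z)%C); nra. }
  (* At a zero of [F] the strictly positive quantity in [Hpos] would be 0. *)
  assert (HF : forall z, Cmod z < 1 -> F z <> 0%C).
  { intros z Hz H; specialize (Hpos z Hz); rewrite H, Cmod_0 in Hpos.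
    replace (kap * (z * F1 z) * Cconj 0)%C with (RtoC 0) in Hpos
      by (unfold Cconj; apply injective_projections; simpl; ring).
    rewrite re_RtoC in Hpos; lra. }
  assert (Hkap : Re kap = cos la) by (unfold kap, cis; simpl; apply cos_neg).
  repeat split; try apply Hla.
  - intros z Hz; eexists; apply Hf, Hz.
  - ring.
  - rewrite (Hf' 0%C H0), F_0; ring.
  - intros z Hz Hz0; apply Cmult_neq_0; [exact Hz0|apply HF, Hz].
  - intros z Hz; unfold zf_quotient; destruct (Ceq_dec z 0) as [Ez|Nz].
    + rewrite Cmult_1_r; fold kap; lra.
    + rewrite (Hf' z Hz); fold kap.
      assert (HFz := HF z Hz).
      assert (HFp : 0 < Cmod (F z) ^ 2) by (apply pow_lt, Cmod_gt_0, HFz).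
      apply Rmult_lt_reg_r with (Cmod (F z) ^ 2); [exact HFp|].
      rewrite Rmult_0_l, <- re_scal_r, Cmod2_conj.
      replace (kap * (z * (F z + z * F1 z) / (z * F z)) * (F z * Cconj (F z)))%C
        with (kap * (F z * Cconj (F z)) + kap * (z * F1 z) * Cconj (F z))%C
        by (field; split; assumption).
      rewrite <- Cmod2_conj, re_plus, re_scal_r, Hkap; apply Hpos, Hz.
Qed.
End HypergeometricEquation.

Theorem corollary1p6 (lambda : R) (a b : C) (q : R)
  (hlambda : (0 < Rabs lambda < PI / 3)%R)
  (hq : (a * b)%C = RtoC q)
  (hq_pos : (0 < q)%R)
  (hcond :
    ((Im (cis lambda * (a + b))%C - 2 * sin (2 * lambda) * cos lambda) ^ 2
     <= (4 * cos lambda ^ 2 - 1) *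
        (2 * Re (cis lambda * (a + b))%C * cos lambda
         - 4 * cos lambda ^ 4 + 3 * cos lambda ^ 2 - q))%R) :
  spirallike lambda (fun z : C => z * hypergeom2F1 a b (a + b + 1) z)%C.
Proof.
  assert (Hpi := PI_RGT_0).
  assert (Hla : - (PI / 3) < lambda < PI / 3) by (apply Rabs_lt_between, hlambda).
  assert (Hcos : 1 / 2 < cos lambda).
  { rewrite <- cos_PI3; unfold Rabs in hlambda; destruct (Rcase_abs lambda).
    - rewrite <- (cos_neg lambda); apply cos_decreasing_1; lra.
    - apply cos_decreasing_1; lra. }
  assert (Hm : 0 < 4 * cos lambda ^ 2 - 1) by nra.
  (* The hypothesis with its real part rotated back: [Re (a + b)] is recovered from the parts [W],
     [Z] of [e^(i lambda) (a + b)], and both forms have the same difference of sides. *)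
  assert (Hpar : (Im (cis lambda * (a + b))%C - sin lambda) ^ 2
    <= (4 * cos lambda ^ 2 - 1) * (2 * Re (a + b)%C - 1 - q)).
  { rewrite sin_2a in hcond.
    assert (Hsc := sin2_cos2 lambda); unfold Rsqr in Hsc.
    rewrite re_mult, im_mult in hcond; rewrite im_mult.
    change (Re (cis lambda)) with (cos lambda) in *.
    change (Im (cis lambda)) with (sin lambda) in *.
    set (X := Re (a + b)%C) in *; set (Y := Im (a + b)%C) in *.
    set (c := cos lambda) in *; set (S := sin lambda) in *; clearbody X Y c S.
    assert (E : (4 * c ^ 2 - 1) * (2 * X - 1 - q) - (c * Y + S * X - S) ^ 2
      = (4 * c ^ 2 - 1) * (2 * (c * X - S * Y) * c - 4 * c ^ 4 + 3 * c ^ 2 - q)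
        - (c * Y + S * X - 2 * (2 * S * c) * c) ^ 2).
    { assert (HX : X = c * (c * X - S * Y) + S * (c * Y + S * X)) by (clear - Hsc; nsatz).
      set (W := c * X - S * Y) in *; set (Z := c * Y + S * X) in *; clearbody W Z.
      rewrite HX; clear - Hsc.
      replace ((Z - 2 * (2 * S * c) * c) ^ 2)
        with (Z ^ 2 - 8 * Z * S * c ^ 2 + 16 * (S * S) * c ^ 4) by ring.
      replace ((Z - S) ^ 2) with (Z ^ 2 - 2 * Z * S + S * S) by ring.
      replace (S * S) with (1 - c * c) by lra; ring. }
    lra. }
  (* The parabola condition alone gives [2 Re (a + b) >= 1 + q], so the lower parameter avoids 0,
     -1, -2, ... *)
  assert (HRe : 0 < Re (a + b + 1)%C).
  { rewrite re_plus, re_RtoC.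
    assert (T := pow2_ge_0 (Im (cis lambda * (a + b))%C - sin lambda)).
    assert (0 <= 2 * Re (a + b)%C - 1 - q) by nra.
    lra. }
  set (t := hypergeom_coef a b (a + b + 1)%C).
  assert (Ht : disk_summable t) by exact (disk_summable_hypergeom a b _ HRe).
  assert (Ht1 := disk_summable_derive t Ht).
  assert (Ht2 := disk_summable_derive _ Ht1).
  apply (spirallike_of_ode (CPSeries t) (CPSeries (CPS_derive t))
    (CPSeries (CPS_derive (CPS_derive t))) (a + b)%C q).
  - intros z Hz; apply is_derive_CPSeries; assumption.
  - intros z Hz; apply is_derive_CPSeries; assumption.
  - rewrite CPSeries_0 by exact Ht.
    unfold t, hypergeom_coef; simpl; field.
  - intros z Hz; rewrite <- hq; apply hypergeom_ode; assumption.
  - intros z Hz; eexists; apply is_derive_CPSeries; assumption.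
  - exact hq_pos.
  - lra.
  - exact Hm.
  - exact Hpar.
  - lra.
Qed.
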